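(* The test $T_{\mathrm{GN}}$ (repeated a constant number of times) is a tolerant tester for $\mathrm{RM}(d,n)$. That is, there exist absolute constants $c_1,c_2>0$ and an integer $r\ge 1$ such that for all integers $d\ge 0$ and $n\ge d+1$, the tester which runs $T_{\mathrm{GN}}^f$ independently $r$ times and accepts if and only if all $r$ runs accept satisfies, for every $f:\mathbb{F}_2^n\to\mathbb{F}_2$: 1. (acceptance condition) if $\delta_d(f)\le c_1 2^{-d}$, then it accepts with probability at least $2/3$; 2. (rejection condition) if $\delta_d(f)\ge c_2 2^{-d}$, then it rejects with probability at least $2/3$.
   Context: Every function $f:\mathbb{F}_2^n\to\mathbb{F}_2$ is uniquely a multilinear polynomial over $\mathbb{F}_2$; $\deg f$ is its degree. $\mathrm{RM}(d,n)=\{g:\mathbb{F}_2^n\to\mathbb{F}_2 : \deg g\le d\}$, a code of minimum relative distance $\delta_{\min}=2^{-d}$. $\delta_d(f)=\min_{g\in\mathrm{RM}(d,n)}\Pr_{x}[f(x)\ne g(x)]$, with $x$ uniform in $\mathbb{F}_2^n$. A tolerant tester for a code of minimum relative distance $\delta_{\min}$ is a randomized oracle algorithm for which there are constants $c_1,c_2$ such that it accepts words within distance $c_1\delta_{\min}$ of the code with probability at least $2/3$ and rejects words at least $c_2\delta_{\min}$-far from the code with probability at least $2/3$. The test $T_{\mathrm{GN}}^f$ (with degree parameter $d$) picks a uniformly random $(d+1)$-dimensional affine subspace $A\subseteq\mathbb{F}_2^n$ and accepts if and only if $f|_A$ (viewed as a function on $\mathbb{F}_2^{d+1}$ through any affine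 parametrization of $A$) has degree at most $d$. *)

(* Defs.v *)
From mathcomp Require Import all_boot all_order all_algebra.
From mathcomp Require Import reals.
From mathcomp Require Import mpoly.

Set Implicit Arguments.
Unset Strict Implicit.
Unset Printing Implicit Defensive.

Import Order.TTheory GRing.Theory Num.Theory.
Local Open Scope ring_scope.

Notation F2vec n := 'rV['F_2]_n.
Notation boolfun n := {ffun F2vec n -> 'F_2}.

Definition multilinear (n : nat) (p : {mpoly 'F_2[n]}) : bool :=
  all (fun m : 'X_{1..n} => [forall i, m i <= 1]%N) (msupp p).

Definition mpoly_fun (n : nat) (p : {mpoly 'F_2[n]}) : boolfun n :=
  [ffun x : F2vec n => p.@[fun i => x 0 i]].

(* The multilinear polynomial of f, by interpolation: the product is the
   indicator of the point a, since 1 + 'X_i = 1 - 'X_i over 'F_2.  The lemmas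
   anf_multilinear, mpoly_fun_anf and anf_unique below show that it is the
   unique multilinear polynomial computing f. *)
Definition anf (n : nat) (f : boolfun n) : {mpoly 'F_2[n]} :=
  \sum_(a : F2vec n)
    f a *: \prod_(i < n) (if a 0 i == 1 then 'X_i else 1 + 'X_i).

(* msize is the total degree plus one, and 0 for the zero polynomial; so the
   zero function has degree 0 here. *)
Definition deg (n : nat) (f : boolfun n) : nat := (msize (anf f)).-1.

Definition RM (d n : nat) : {set boolfun n} := [set g | deg g <= d]%N.

Definition unif_prob (R : realType) (T : finType) (Omega : {set T})
    (E : pred T) : R :=
  #|[set w in Omega | E w]|%:R / #|Omega|%:R.

(* The minimum is over a nonempty set of numbers that are at most 1, so the
   default value 1 of the iterated minimum does not affect it. *)
Definition delta (R : realType) (d n : nat) (f : boolfun n) : R :=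
  \big[Num.min/1]_(g in RM d n)
    unif_prob R [set: F2vec n] (fun x => f x != g x).

Definition affine_map (k n : nat) (a : F2vec n) (M : 'M['F_2]_(k, n))
    (u : F2vec k) : F2vec n := a + u *m M.

(* The map affine_map a M is injective exactly when M is row_free. *)
Definition affine_subspaces (k n : nat) : {set {set F2vec n}} :=
  [set A | [exists a : F2vec n, exists M : 'M['F_2]_(k, n),
     row_free M && (A == affine_map a M @: [set: F2vec k])]].

Definition pullback (k n : nat) (f : boolfun n) (a : F2vec n)
    (M : 'M['F_2]_(k, n)) : boolfun k :=
  [ffun u : F2vec k => f (affine_map a M u)].

Definition restriction_deg_le (k n : nat) (d : nat) (f : boolfun n)
    (A : {set F2vec n}) : bool :=
  [forall a : F2vec n, forall M : 'M['F_2]_(k, n),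
     (row_free M && (A == affine_map a M @: [set: F2vec k])) ==>
     (deg (pullback f a M) <= d)%N].

Definition GN_accepts (d n : nat) (f : boolfun n) (A : {set F2vec n}) : bool :=
  restriction_deg_le d.+1 d f A.

(* The randomness of r independent runs: all r-tuples of (d+1)-dimensional
   affine subspaces, under the uniform (i.e. product) distribution. *)
Definition GN_runs (d n r : nat) : {set {ffun 'I_r -> {set F2vec n}}} :=
  [set A : {ffun 'I_r -> {set F2vec n}} |
     [forall i, A i \in affine_subspaces d.+1 n]].

Definition repeated_GN_accepts (d n r : nat) (f : boolfun n)
    (A : {ffun 'I_r -> {set F2vec n}}) : bool :=
  [forall i, GN_accepts d f (A i)].

Definition accept_prob (R : realType) (d n r : nat) (f : boolfun n) : R :=
  unif_prob R (GN_runs d n r) (fun A => repeated_GN_accepts d f A).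

Definition reject_prob (R : realType) (d n r : nat) (f : boolfun n) : R :=
  unif_prob R (GN_runs d n r) (fun A => ~~ repeated_GN_accepts d f A).

Lemma F2_cases (x : 'F_2) : x = 0 \/ x = 1.
Proof.
by case: x => [[|[|m]] hm] //; [left|right]; apply: val_inj.
Qed.

Lemma mpoly_fun_anf (n : nat) (f : boolfun n) : mpoly_fun (anf f) = f.
Proof.
apply/ffunP => x; rewrite ffunE /anf raddf_sum /= (bigD1 x) //=.
rewrite [X in _ + X]big1 => [|a nax].
  rewrite addr0 mevalZ rmorph_prod /= big1 ?mulr1 // => i _.
  by case: (F2_cases (x 0 i)) => xi; rewrite xi /= ?mevalD ?meval1 mevalXU xi ?addr0.
rewrite mevalZ rmorph_prod /=.
have [i nai] : exists i, a 0 i != x 0 i.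
  apply/existsP; apply: contraNT nax => /existsPn h; apply/eqP/rowP => i.
  by apply/eqP; move: (h i); rewrite negbK.
rewrite (bigD1 i) //=.
suff -> : (if a 0 i == 1 then 'X_i else 1 + 'X_i).@[fun j => x 0 j] = 0.
  by rewrite mul0r mulr0.
move: nai; case: (F2_cases (a 0 i)) => ->; case: (F2_cases (x 0 i)) => xi;
  rewrite xi //= => _; rewrite ?mevalD ?meval1 mevalXU xi //.
by apply: val_inj.
Qed.

Lemma anf_multilinear (n : nat) (f : boolfun n) : multilinear (anf f).
Proof.
pose l (a : F2vec n) i : {mpoly 'F_2[n]} :=
  if a 0 i == 1 then 'X_i else 1 + 'X_i.
have supp_l a i m : m \in msupp (l a i) -> (m == 0%MM) || (m == U_(i)%MM).
  rewrite /l; case: ifP => _; first by rewrite msuppX inE => ->; rewrite orbT.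
  by move/msuppD_le; rewrite mem_cat msupp1 msuppX !inE.
have supp_prod a (s : seq 'I_n) : uniq s ->
    forall m, m \in msupp (\prod_(i <- s) l a i) -> forall j, (m j <= (j \in s))%N.
  elim: s => [_ m|i s IHs /= /andP[nis us] m].
    by rewrite big_nil msupp1 inE => /eqP-> j; rewrite mnm0E.
  rewrite big_cons => /msuppM_le/allpairsP[[m1 m2] /= [/supp_l h1 h2 ->]] j.
  have := IHs us _ h2 j; rewrite mnmDE inE [j == i]eq_sym.
  case/orP: h1 => /eqP->; first by rewrite mnm0E; case: (i == j); case: (j \in s) => //= /leqW.
  rewrite mnm1E; case: eqP => [<-|_] //=.
  by rewrite (negbTE nis) leqn0 => /eqP->.
apply/allP => m /msupp_sum_le/flattenP[_ /mapP[a _ ->]] /msuppZ_le hm.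
apply/forallP => j; apply: leq_trans (supp_prod a _ (index_enum_uniq _) m hm j) _.
by case: (_ \in _).
Qed.

Lemma multilinear_fun0 (n : nat) (p : {mpoly 'F_2[n]}) :
  multilinear p -> (forall x : F2vec n, p.@[fun i => x 0 i] = 0) -> p = 0.
Proof.
move=> /allP mlp p0; apply/eqP; apply: contraT => np.
have [m0 hm0] : exists m, m \in msupp p.
  by exists (mlead p); apply: mlead_supp.
have [k] := ubnP (mdeg m0); elim: k m0 hm0 => // k IHk m mp mk.
pose x : F2vec n := \row_i (m i)%:R.
have mon m' : m' \in msupp p -> \prod_i (x 0 i : 'F_2) ^+ m' i != 0 ->
    forall i, (m' i <= m i)%N.
  move=> m'p nz i; have /forallP/(_ i) := mlp _ m'p.
  have := nz; rewrite (bigD1 i) //= mulf_eq0 negb_or mxE => /andP[+ _].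
  have /forallP/(_ i) := mlp _ mp.
  by case: (m i) (m' i) => [|[|?]] [|[|?]].
have := p0 x; rewrite mevalE (bigD1_seq m) //=.
have -> : \prod_i (x 0 i : 'F_2) ^+ m i = 1.
  rewrite big1 // => i _; rewrite mxE; have /forallP/(_ i) := mlp _ mp.
  by case: (m i) => [|[|?]].
case: (boolP (has (fun m' => (m' != m) && (\prod_i (x 0 i : 'F_2) ^+ m' i != 0))
                  (msupp p))) => [/hasP[m' m'p /andP[nm nz]] _|/hasPn hn].
  apply: (IHk m' m'p); have le := mon _ m'p nz.
  rewrite ltnS in mk; apply: leq_trans mk.
  have [i ni] : exists i, m' i != m i.
    apply/existsP; apply: contraNT nm => /existsPn h; apply/eqP/mnmP => i.
    by apply/eqP; move: (h i); rewrite negbK.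
  rewrite !mdegE (bigD1 i) //= [X in (_ < X)%N](bigD1 i) //=.
  rewrite -addSn leq_add //; first by rewrite ltn_neqAle ni le.
  by apply: leq_sum.
rewrite big1_seq => [|m' /andP[nm m'p]].
  by rewrite addr0 mulr1 => h0; move: mp; rewrite mcoeff_msupp h0 eqxx.
by have := hn _ m'p; rewrite nm /= negbK => /eqP->; rewrite mulr0.
Qed.

Lemma anf_unique (n : nat) (f : boolfun n) (p : {mpoly 'F_2[n]}) :
  multilinear p -> mpoly_fun p = f -> p = anf f.
Proof.
move=> mlp pf; apply/subr0_eq/multilinear_fun0.
  apply/allP => m /msuppB_le; rewrite mem_cat => /orP[] hm.
    by apply: (allP mlp).
  by apply: (allP (anf_multilinear f)).
move=> x; rewrite mevalB; apply/eqP; rewrite subr_eq0; apply/eqP.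
by move/ffunP/(_ x): pf; rewrite -{1}(mpoly_fun_anf f) !ffunE.
Qed.

(* Main.v *)
Require Import Defs.
From mathcomp Require Import all_boot all_order all_algebra.
From mathcomp Require Import reals.
From mathcomp Require Import mpoly.
From mathcomp Require Import mxabelem.
From mathcomp Require Import ring lra zify.

Set Implicit Arguments.
Unset Strict Implicit.
Unset Printing Implicit Defensive.

Import Order.TTheory GRing.Theory Num.Theory.
Local Open Scope ring_scope.

(* A function has degree at most d iff its (d+1)-fold derivatives vanish, so the
   test rejects a flat a + <v_0, ..., v_d> iff f has odd sum over it. Dependent
   directions give the sum 0, so the rejection probability is at least the
   probability rej that a uniform parallelepiped, with independent uniform
   directions, has odd sum.

   Acceptance is a union bound over the 2^(d+1) points of the flat. For rejection
   let f be 2^-(d+4)-far from RM(d, n); rej is bounded below by induction on n.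
   - If n <= d + 8, let e > d be the exact degree of f. The directions along which
     f loses more than one degree are a subgroup of index at least 2^e, so a
     (d+1)-fold derivative has degree e - d - 1 with probability at least
     prod (1 - 2^-i) > 1/4, and it is then nonzero with probability 2^-(e-d-1).
   - If f is 2^-(d+2)-close to RM(d, n), a second moment argument shows that the
     parallelepiped contains exactly one error with constant probability.
   - Otherwise f is close to RM(d, n-1) on hyperplanes of fewer than 2^(d+6)
     directions, so almost all restrictions of f to hyperplanes are far and the
     induction hypothesis applies. Indeed, polynomials close to f on many
     hyperplanes agree on intersections, hence glue to one polynomial of degree
     at most d, and, as hyperplanes are pairwise independent, almost every point
     lies on many of them. *)

(** * Arithmetic in characteristic 2 *)

Lemma F2_addxx (x : 'F_2) : x + x = 0.
Proof. by case: (F2_cases x) => ->; apply: val_inj. Qed.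

Lemma F2_neq0 (x : 'F_2) : x != 0 -> x = 1.
Proof. by case: (F2_cases x) => ->. Qed.

Lemma F2_addr_eq0 (x y : 'F_2) : (x + y == 0) = (x == y).
Proof. by case: (F2_cases x) => ->; case: (F2_cases y) => ->. Qed.

Lemma F2mx_addxx (m n : nat) (x : 'M['F_2]_(m, n)) : x + x = 0.
Proof. by apply/matrixP => i j; rewrite !mxE F2_addxx. Qed.

Lemma F2mx_addK (m n : nat) (x y : 'M['F_2]_(m, n)) : x + y + y = x.
Proof. by rewrite -addrA F2mx_addxx addr0. Qed.

(** * Directional derivatives and their iterates *)

Definition dirder (n : nat) (v : F2vec n) (f : F2vec n -> 'F_2) : F2vec n -> 'F_2 :=
  fun x => f (x + v) + f x.

(** Encodes deg f < k, by [deg_leP]; degree at most d thus appears as [vanish d.+1]. This form suits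
    induction on derivatives and affine substitution. *)
Fixpoint vanish (n k : nat) (f : F2vec n -> 'F_2) : bool :=
  if k is k'.+1 then [forall v, vanish k' (dirder v f)] else [forall x, f x == 0].

Section Derivatives.
Variable n : nat.
Implicit Types (f g : F2vec n -> 'F_2) (v x : F2vec n).

Lemma vanish0P f : reflect (f =1 fun=> 0) (vanish 0 f).
Proof. by apply: (iffP forallP) => f0 x; apply/eqP. Qed.

Lemma vanishSP k f : reflect (forall v, vanish k (dirder v f)) (vanish k.+1 f).
Proof. exact: forallP. Qed.

Lemma vanishSPn k f : reflect (exists v, ~~ vanish k (dirder v f)) (~~ vanish k.+1 f).
Proof. exact: forallPn. Qed.

Lemma eq_vanish k f g : f =1 g -> vanish k f = vanish k g.
Proof.
elim: k f g => [|k IHk] f g fg /=.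
  by apply: eq_forallb => x; rewrite fg.
by apply: eq_forallb => v; apply: IHk => x; rewrite /dirder !fg.
Qed.

Lemma vanish_zero k : vanish k (fun _ : F2vec n => 0).
Proof.
elim: k => [|k IHk]; first exact/vanish0P.
by apply/vanishSP => v; rewrite -(eq_vanish _ (f := fun=> 0)) // => x; rewrite /dirder addr0.
Qed.

Lemma vanishD k f g : vanish k f -> vanish k g -> vanish k (fun x => f x + g x).
Proof.
elim: k f g => [|k IHk] f g.
  by move=> /vanish0P f0 /vanish0P g0; apply/vanish0P => x; rewrite f0 g0 addr0.
move=> /vanishSP vf /vanishSP vg; apply/vanishSP => v.
rewrite -(eq_vanish _ (f := fun x => dirder v f x + dirder v g x)).
  exact: IHk (vf v) (vg v).
by move=> x; rewrite /dirder addrACA.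
Qed.

Lemma vanish_sum k (I : Type) (r : seq I) (F : I -> F2vec n -> 'F_2) :
  (forall i, vanish k (F i)) -> vanish k (fun x => \sum_(i <- r) F i x).
Proof.
move=> vF; elim: r => [|i r IHr].
  by rewrite -(eq_vanish _ (f := fun=> 0)) ?vanish_zero // => x; rewrite big_nil.
rewrite -(eq_vanish _ (f := fun x => F i x + \sum_(j <- r) F j x)).
  exact: vanishD.
by move=> x; rewrite big_cons.
Qed.

Lemma vanishZ k (c : 'F_2) f : vanish k f -> vanish k (fun x => c * f x).
Proof.
case: (F2_cases c) => -> vf.
  by rewrite -(eq_vanish _ (f := fun=> 0)) ?vanish_zero // => x; rewrite mul0r.
by rewrite -(eq_vanish _ (f := f)) // => x; rewrite mul1r.
Qed.

Lemma vanishS k f : vanish k f -> vanish k.+1 f.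
Proof.
elim: k f => [|k IHk] f.
  by move/vanish0P => f0; apply/vanishSP => v; apply/vanish0P => x; rewrite /dirder !f0 addr0.
by move/vanishSP => vf; apply/vanishSP => v; apply/IHk/vf.
Qed.

Lemma vanish_leq k l f : (k <= l)%N -> vanish k f -> vanish l f.
Proof. by move=> kl vf; rewrite -(subnK kl); elim: (_ - _)%N => // m /vanishS. Qed.

(** Product rule: the derivative of x_i f along v is x_i D_v f + v_i f(x + v), where f(x + v) = D_v
    f + f. Induction treats the first term, the hypothesis on f the second. *)
Lemma vanishM_coord k i f : vanish k f -> vanish k.+1 (fun x => x 0 i * f x).
Proof.
elim: k f => [|k IHk] f vf; apply/vanishSP => v.
  by apply/vanish0P => x; rewrite /dirder !(vanish0P _ vf) !mulr0 addr0.
pose shifted x := f (x + v).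
rewrite -(eq_vanish _ (f := fun x => x 0 i * dirder v f x + v 0 i * shifted x)).
  apply: vanishD; first by apply: IHk; apply: (vanishSP _ _ vf).
  apply: vanishZ; rewrite -(eq_vanish _ (f := fun x => dirder v f x + f x)).
    by apply: vanishD => //; apply: vanishS; apply: (vanishSP _ _ vf).
  by move=> x; rewrite /dirder /shifted -addrA F2_addxx addr0.
by move=> x; rewrite /dirder /shifted mxE; ring.
Qed.

End Derivatives.

Lemma vanish_affine (m n k : nat) (f : F2vec n -> 'F_2) a (M : 'M_(m, n)) :
  vanish k f -> vanish k (fun u => f (a + u *m M)).
Proof.
elim: k f => [|k IHk] f.
  by move/vanish0P => f0; apply/vanish0P => u; rewrite f0.
move/vanishSP => vf; apply/vanishSP => v.
rewrite -(eq_vanish _ (f := fun u => dirder (v *m M) f (a + u *m M))).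
  exact: IHk (vf _).
by move=> u; rewrite /dirder mulmxDl addrA.
Qed.

Lemma vanish_shift (n k : nat) (f : F2vec n -> 'F_2) a :
  vanish k f -> vanish k (fun x => f (x + a)).
Proof.
move/(vanish_affine a 1%:M); rewrite -(eq_vanish _ (f := fun x => f (x + a))) //.
by move=> x; rewrite mulmx1 addrC.
Qed.

(** * Monomials, and degree in terms of derivatives *)

Definition mono (n : nat) (T : {set 'I_n}) (x : F2vec n) : 'F_2 :=
  \prod_(i in T) x 0 i.

Lemma vanish_mono (n : nat) (T : {set 'I_n}) : vanish #|T|.+1 (mono T).
Proof.
have [m] := ubnP #|T|; elim: m T => // m IHm T Tm.
have [->|[i iT]] := set_0Vmem T.
  rewrite cards0; apply/vanishSP => v; apply/vanish0P => x.
  by rewrite /dirder /mono !big_set0 F2_addxx.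
rewrite -(eq_vanish _ (f := fun x => x 0 i * mono (T :\ i) x)).
  by move: Tm; rewrite (cardsD1 i) iT add1n ltnS => /IHm vT; exact: vanishM_coord.
by move=> x; rewrite /mono (big_setD1 i iT).
Qed.

Lemma dirder_mono (n : nat) (T : {set 'I_n}) (i : 'I_n) (x : F2vec n) :
  dirder (delta_mx 0 i) (mono T) x = if i \in T then mono (T :\ i) x else 0.
Proof.
have notin (S : {set _}) : i \notin S -> mono S (x + delta_mx 0 i) = mono S x.
  move=> iS; apply: eq_bigr => j jS; rewrite !mxE eqxx /=.
  by case: eqP => [ji|]; [rewrite -ji jS in iS | rewrite addr0].
rewrite /dirder; case: ifP => iT; last by rewrite notin ?iT // F2_addxx.
rewrite {1 2}/mono !(big_setD1 i iT) /= -/(mono _ _) -[X in _ + _ * X]/(mono _ _).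
rewrite notin ?setD11 // mxE mxE !eqxx -mulrDl /= addrAC F2_addxx add0r.
by rewrite mul1r.
Qed.

Definition msupport (n : nat) (m : 'X_{1..n}) : {set 'I_n} := [set i | m i != 0]%N.

Lemma mnm_multilinear (n : nat) (p : {mpoly 'F_2[n]}) (m : 'X_{1..n}) i :
  multilinear p -> m \in msupp p -> m i = (i \in msupport m) :> nat.
Proof.
move=> /allP mlp /mlp /forallP/(_ i); rewrite inE.
by case: (m i) => [|[|?]].
Qed.

Lemma card_msupport (n : nat) (p : {mpoly 'F_2[n]}) (m : 'X_{1..n}) :
  multilinear p -> m \in msupp p -> #|msupport m| = mdeg m.
Proof.
move=> mlp mp; rewrite mdegE -sum1_card big_mkcond /=.
by apply: eq_bigr => i _; rewrite (mnm_multilinear i mlp mp); case: ifP.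
Qed.

Lemma mpoly_fun_mono (n : nat) (p : {mpoly 'F_2[n]}) (x : F2vec n) :
  multilinear p -> mpoly_fun p x = \sum_(m <- msupp p) p@_m * mono (msupport m) x.
Proof.
move=> mlp; rewrite ffunE mevalE; apply: eq_big_seq => m mp.
congr (_ * _); rewrite /mono [RHS]big_mkcond /=; apply: eq_bigr => i _.
by rewrite (mnm_multilinear i mlp mp); case: ifP.
Qed.

(** Each derivative along a basis vector strikes its variable out of the monomial, or kills the
    monomial if the variable is absent. Evaluation at 0 then reads off coefficients. *)
Lemma foldr_dirder_mono (n : nat) (s : seq 'I_n) (T : {set 'I_n}) : uniq s ->
  foldr (fun i => dirder (delta_mx 0 i)) (mono T) s =1
  if [set:: s] \subset T then mono (T :\: [set:: s]) else fun=> 0.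
Proof.
elim: s => [_ x|i s IHs /= /andP[nis us] x].
  by rewrite set_nil sub0set setD0.
rewrite {1}/dirder !IHs // set_cons subUset sub1set.
case: ifP => sT; last by rewrite andbF addr0.
rewrite andbT; have := dirder_mono (T :\: [set:: s]) i x; rewrite /dirder => ->.
by rewrite !inE nis /=; case: ifP => // _; rewrite setDDl setUC.
Qed.

Lemma foldr_dirder_sum (n : nat) (s : seq 'I_n) (I : Type) (r : seq I) (F : I -> F2vec n -> 'F_2) c :
  foldr (fun i => dirder (delta_mx 0 i)) (fun x => \sum_(i <- r) c i * F i x) s =1
  fun x => \sum_(i <- r) c i * foldr (fun i => dirder (delta_mx 0 i)) (F i) s x.
Proof.
elim: s => //= i s IHs x; rewrite /dirder !IHs -big_split /=.
by apply: eq_bigr => j _; rewrite mulrDr.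
Qed.

Lemma eq_foldr_dirder (n : nat) (s : seq 'I_n) (f g : F2vec n -> 'F_2) :
  f =1 g -> foldr (fun i => dirder (delta_mx 0 i)) f s =1 foldr (fun i => dirder (delta_mx 0 i)) g s.
Proof. by move=> fg; elim: s => //= i s IHs x; rewrite /dirder !IHs. Qed.

Lemma vanish_foldr (n : nat) (s : seq 'I_n) (f : F2vec n -> 'F_2) x :
  vanish (size s) f -> foldr (fun i => dirder (delta_mx 0 i)) f s x = 0.
Proof.
suff vs k : vanish (k + size s) f -> vanish k (foldr (fun i => dirder (delta_mx 0 i)) f s).
  by move/(vs 0%N)/vanish0P.
elim: s k => [k|i s IHs k] /=; first by rewrite addn0.
by rewrite addnS -addSn => /IHs/vanishSP.
Qed.

(** Monomials of degree at most d die after d + 1 derivatives. Conversely, if the leading monomial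
    has larger degree, differentiate along its variables and evaluate at 0: its coefficient
    survives, monomials lacking one of the variables die, and those with a further variable vanish
    at 0. *)
Lemma deg_leP (n d : nat) (f : boolfun n) : reflect (vanish d.+1 f) (deg f <= d)%N.
Proof.
have mlp := anf_multilinear f; have fE x : f x = \sum_(m <- msupp (anf f))
    (anf f)@_m * mono (msupport m) x by rewrite -mpoly_fun_mono // mpoly_fun_anf.
apply: (iffP idP) => [degf|vf].
  have {degf} sp : (msize (anf f) <= d.+1)%N by move: degf; rewrite /deg; case: (msize _).
  pose F m := if m \in msupp (anf f)
    then (fun x => (anf f)@_m * mono (msupport m) x) else fun=> 0.
  rewrite -(eq_vanish _ (f := fun x => \sum_(m <- msupp (anf f)) F m x)).
    apply: (@vanish_sum n d.+1 _ _ F) => m; rewrite /F; case: ifP => mp; last exact: vanish_zero.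
    apply/vanishZ/(vanish_leq _ (vanish_mono _)).
    by rewrite (card_msupport mlp mp); apply: leq_trans sp; apply: msize_mdeg_lt.
  by move=> x; rewrite fE; apply: eq_big_seq => m mp; rewrite /F mp.
rewrite /deg; case def_p: (anf f == 0); first by rewrite (eqP def_p) msize0.
rewrite leqNgt; apply/negP => dp.
pose m := mlead (anf f); have mp : m \in msupp (anf f) by rewrite mlead_supp ?def_p.
have dm : (d.+1 <= #|msupport m|)%N.
  rewrite (card_msupport mlp mp); move: dp.
  by rewrite -mlead_deg ?def_p.
pose s := enum (msupport m).
have : foldr (fun i => dirder (delta_mx 0 i)) f s 0 = 0.
  by rewrite vanish_foldr // (vanish_leq _ vf) // -cardE.
rewrite (eq_foldr_dirder _ fE) foldr_dirder_sum (bigD1_seq m) //= big1_seq => [|m' /andP[nm m'p]].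
  rewrite foldr_dirder_mono ?enum_uniq // set_enum subxx setDv addr0 /mono big_set0 mulr1.
  by move=> c0; move: mp; rewrite mcoeff_msupp c0 eqxx.
rewrite foldr_dirder_mono ?enum_uniq // set_enum; case: ifP => sT; last by rewrite mulr0.
have [j] : exists j, j \in msupport m' :\: msupport m.
  apply/set0Pn; rewrite setD_eq0; apply: contraNN nm => Ts.
  have eT : msupport m' = msupport m by apply/eqP; rewrite eqEsubset Ts.
  apply/eqP/mnmP => i.
  by rewrite (mnm_multilinear i mlp m'p) (mnm_multilinear i mlp mp) eT.
by move=> jT; rewrite /mono (bigD1 j) //= mxE mul0r mulr0.
Qed.

(** * Minimum distance and degree-lowering directions *)

Lemma F2_addK (x y : 'F_2) : x + y + y = x.
Proof. by rewrite -addrA F2_addxx addr0. Qed.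

Lemma card_F2mx (m n : nat) : #|{: 'M['F_2]_(m, n)}| = (2 ^ (m * n))%N.
Proof. by rewrite card_mx card_Fp. Qed.

Lemma card_F2vec (n : nat) : #|{: F2vec n}| = (2 ^ n)%N.
Proof. by rewrite card_F2mx mul1n. Qed.

(** The minimum distance of Reed-Muller codes, on the coset x + W. Unless f is constant there, some
    derivative D_w f is nonzero at x and has smaller degree; each of its nonzeros u makes f nonzero
    at u or u + w, so f has at least half as many nonzeros. *)
Lemma min_dist (n e : nat) (f : F2vec n -> 'F_2) (W : {set F2vec n}) x :
  vanish e.+1 f -> f x != 0 -> {in W &, forall u v, u + v \in W} ->
  (#|W| <= 2 ^ e * #|[set w in W | f (x + w)%R != 0%R]|)%N.
Proof.
move=> vf fx addW; elim: e f vf fx => [|e IHe] f vf fx.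
  rewrite mul1n subset_leq_card //; apply/subsetP => w wW; rewrite inE wW /=.
  have /vanishSP/(_ w)/vanish0P/(_ x)/eqP := vf.
  by rewrite /dirder F2_addr_eq0 => /eqP->.
have [/forall_inP cst|] := boolP [forall w in W, f (x + w) == f x].
  apply: leq_trans (leq_pmull _ _); rewrite ?expn_gt0 //.
  by rewrite subset_leq_card //; apply/subsetP => w wW; rewrite inE wW (eqP (cst w wW)).
case/forall_inPn => w wW ne; have /vanishSP/(_ w) vDf := vf.
have Dfx : dirder w f x != 0 by rewrite /dirder F2_addr_eq0.
apply: leq_trans (IHe _ vDf Dfx) _.
set A := [set w in W | f (x + w)%R != 0%R].
rewrite expnSr -mulnA leq_mul2l; apply/orP; right.
apply: (@leq_trans #|A :|: [set u + w | u in A]|).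
  apply/subset_leq_card/subsetP => u; rewrite !inE => /andP[uW].
  rewrite uW /= /dirder => Dne; have [f0 /=|//] := eqVneq (f (x + u)) 0.
  apply/imsetP; exists (u + w); last by rewrite F2mx_addK.
  by rewrite inE addW //= addrA; rewrite f0 addr0 in Dne.
rewrite mul2n -addnn; apply: leq_trans (leq_card_setU _ _) _.
by rewrite leq_add2l leq_imset_card.
Qed.

Lemma card_kernel (n l : nat) (X : 'M['F_2]_(n, l)) :
  #|[set x : F2vec n | x *m X == 0]| = (2 ^ (n - \rank X))%N.
Proof.
have := card_rowg (kermx X); rewrite mxrank_ker card_Fp // => <-.
by apply: eq_card => x; rewrite !inE sub_kermx.
Qed.

Lemma double_card_leq (T : finType) (h : T -> T) (A B : {set T}) : injective h ->
  A \subset B -> {in A, forall x, h x \in B} -> {in A, forall x, h x \notin A} ->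
  (#|A| * 2 <= #|B|)%N.
Proof.
move=> injh sAB hB hA; rewrite muln2 -addnn -{2}(card_imset A injh).
have /leqifP := leq_card_setU A (h @: A).
have -> : [disjoint A & h @: A].
  apply/pred0P => x /=; apply/negP => /andP[xA /imsetP[y yA xy]].
  by have := hA y yA; rewrite -xy xA.
move/eqP <-; apply/subset_leq_card; rewrite subUset sAB /=.
by apply/subsetP => _ /imsetP[y yA ->]; apply: hB.
Qed.

Lemma dirder_addl (n : nat) (u v x : F2vec n) f : dirder (u + v) f x = dirder u f (x + v) + dirder v f x.
Proof. by rewrite /dirder [RHS]addrA F2_addK [u + v]addrC addrA. Qed.

Lemma dirder_comm (n : nat) (u v x : F2vec n) f : dirder u (dirder v f) x = dirder v (dirder u f) x.
Proof. by rewrite /dirder [x + u + v]addrAC addrACA. Qed.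

Lemma dirder_self (n : nat) (u x : F2vec n) f : dirder u (dirder u f) x = 0.
Proof. by rewrite /dirder F2mx_addK [f x + _]addrC F2_addxx. Qed.

Lemma vanish_dirder_addl (n e : nat) (u v : F2vec n) (f : F2vec n -> 'F_2) :
  vanish e (dirder v f) -> vanish e (dirder (u + v) f) -> vanish e (dirder u f).
Proof.
move=> vv vuv.
rewrite -(eq_vanish _ (f := fun x => dirder (u + v) f (x + v) + dirder v f (x + v))).
  by apply: vanishD; apply: (vanish_shift v).
by move=> x; rewrite dirder_addl F2_addK F2mx_addK.
Qed.

(* The directions lowering the degree form a subgroup; passing from f to
   dirder u f for a u outside of it at least doubles it. *)
Lemma card_low_directions (n e : nat) (f : F2vec n -> 'F_2) : ~~ vanish e.+1 f ->
  (#|[set v | vanish e (dirder v f)]| * 2 ^ e.+1 <= 2 ^ n)%N.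
Proof.
have inju (u : F2vec n) : injective (fun v => u + v) by apply: addrI.
elim: e f => [|e IHe] f /vanishSPn[u ndu].
  rewrite -(card_F2vec n) -cardsT; apply: (double_card_leq (inju u)).
  - exact: subsetT.
  - by move=> v _; rewrite inE.
  - by move=> v; rewrite !inE => vv; apply: contraNN ndu; apply: vanish_dirder_addl vv.
apply: leq_trans (IHe _ ndu); rewrite expnS mulnA leq_mul2r.
apply/orP; right; apply: (double_card_leq (inju u)).
- apply/subsetP => v; rewrite !inE => /vanishSP/(_ u).
  by rewrite (eq_vanish _ (dirder_comm u v ^~ f)).
- move=> v; rewrite !inE => /vanishSP/(_ u); rewrite (eq_vanish _ (dirder_comm u v ^~ f)).
  rewrite (eq_vanish _ (g := dirder (u + v) (dirder u f))) // => x.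
  by rewrite dirder_addl dirder_self add0r.
- by move=> v; rewrite !inE => vv; apply: contraNN ndu; apply: vanish_dirder_addl vv.
Qed.

(** * Sums over parallelepipeds *)

(** The k-fold derivative of f at a along the rows of M, by [cubesumS]; for dependent rows a point
    is counted with multiplicity. *)
Definition cubesum (k n : nat) (f : F2vec n -> 'F_2) a (M : 'M_(k, n)) : 'F_2 :=
  \sum_(u : F2vec k) f (a + u *m M).

Definition odd_cubes (k n : nat) (f : F2vec n -> 'F_2) : {set F2vec n * 'M['F_2]_(k, n)} :=
  [set p | cubesum f p.1 p.2 != 0].

Lemma cubesum0 (n : nat) (f : F2vec n -> 'F_2) a (M : 'M_(0, n)) : cubesum f a M = f a.
Proof.
rewrite /cubesum (big_pred1 0) => [|u]; first by rewrite mul0mx addr0.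
by rewrite /= [u]thinmx0 eqxx.
Qed.

Lemma cubesumS (k n : nat) (f : F2vec n -> 'F_2) a v (M : 'M_(k, n)) :
  @cubesum (1 + k) n f a (col_mx v M) = cubesum (dirder v f) a M.
Proof.
rewrite /cubesum.
rewrite (reindex (fun p : 'F_2 * F2vec k => row_mx p.1%:M p.2 : F2vec (1 + k))) /=.
  rewrite -(pair_bigA _ (fun c w => f (a + row_mx c%:M w *m col_mx v M))) /=.
  rewrite exchange_big /=; apply: eq_bigr => w _.
  rewrite (bigD1 0) //= (bigD1 1) //= big1 => [|c]; last first.
    by case: (F2_cases c) => ->.
  rewrite !mul_row_col !mul_scalar_mx scale0r scale1r add0r addr0.
  by rewrite addrC /dirder -addrA [w *m M + v]addrC.
exists (fun u : F2vec (1 + k) => (lsubmx u 0 0, rsubmx u)).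
  by move=> [c w] _; rewrite row_mxKl row_mxKr mxE.
by move=> u _ /=; rewrite -mx11_scalar hsubmxK.
Qed.

Lemma vanish_cubesumP (k n : nat) (f : F2vec n -> 'F_2) :
  reflect (forall a (M : 'M_(k, n)), cubesum f a M = 0) (vanish k f).
Proof.
elim: k f => [|k IHk] f.
  apply: (iffP (vanish0P f)) => [f0 a M|S0 x]; first by rewrite cubesum0 f0.
  by rewrite -(cubesum0 f x 0).
apply: (iffP (vanishSP k f)) => [vf a M|S0 v].
  by rewrite -(@vsubmxK _ 1 k n M) cubesumS; apply/IHk/vf.
by apply/IHk => a M; rewrite -cubesumS.
Qed.

Lemma card_odd_cubes0 (n : nat) (f : F2vec n -> 'F_2) :
  #|odd_cubes 0 f| = #|[set x | f x != 0]|.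
Proof.
have inj : injective (fun x : F2vec n => (x, 0 : 'M['F_2]_(0, n))) by move=> x y [].
rewrite -(card_imset _ inj); apply: eq_card => -[x M].
rewrite inE /= cubesum0 (flatmx0 M); apply/idP/imsetP => [fx|[y]].
  by exists x; rewrite ?inE.
by rewrite inE => fy [->].
Qed.

Lemma card_odd_cubesS (k n : nat) (f : F2vec n -> 'F_2) :
  #|odd_cubes k.+1 f| = (\sum_(v : F2vec n) #|odd_cubes k (dirder v f)|)%N.
Proof.
have inj : injective (fun q : {v : F2vec n & F2vec n * 'M['F_2]_(k, n)}%type =>
   let: existT v p := q in (p.1, col_mx v p.2 : 'M_(1 + k, n))).
  by move=> [v [a M]] [v' [a' M']] /= [-> /eq_col_mx[-> ->]].
under eq_bigr do rewrite -sum1_card.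
rewrite (sig_big_dep _ (fun v p => p \in odd_cubes k (dirder v f)) (fun _ _ => 1%N)) /=.
rewrite sum1dep_card -(card_imset _ inj); apply: eq_card => -[a M].
rewrite -[M](@vsubmxK _ 1 k n) inE /= cubesumS; apply/idP/imsetP => [Sne|].
  by exists (existT _ (@usubmx _ 1 k n M) (a, @dsubmx _ 1 k n M)); rewrite ?inE.
by case=> -[v [a' M']]; rewrite !inE /= => Sne [-> eM]; have [-> ->] := @eq_col_mx _ 1 k n _ _ _ _ eM.
Qed.

(** * Rejection probability of a function of known exact degree *)

Section Rejection.
Variable R : realFieldType.

(** All matrices M are counted, not just the row-free ones, so that the directions are independent
    and [rejS] is an exact average over the first of them. *)
Definition rej (k n : nat) (f : F2vec n -> 'F_2) : R :=
  #|odd_cubes k f|%:R / 2 ^+ (n * k.+1).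

Lemma rej_ge0 (k n : nat) (f : F2vec n -> 'F_2) : 0 <= rej k f.
Proof. by rewrite divr_ge0 ?exprn_ge0. Qed.

Lemma rejS (k n : nat) (f : F2vec n -> 'F_2) :
  rej k.+1 f = (\sum_(v : F2vec n) rej k (dirder v f)) / 2 ^+ n.
Proof.
rewrite /rej card_odd_cubesS natr_sum -mulr_suml -mulrA -invfM -exprD.
by rewrite mulnSr.
Qed.

(* The probability that e uniform vectors of an e-dimensional binary space are
   linearly independent. *)
Definition indep_prob (e : nat) : R := \prod_(i < e) (1 - 2 ^- i.+1).

Lemma indep_prob_gt (e : nat) : 1 / 4 < indep_prob e.
Proof.
(* The bound is strengthened to survive induction: with y = 2^-(m+2) <= 1/4, (1/4 + y)(1 - y) >= 1/4
   + y/2. *)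
suff h m : 1 / 4 + 2 ^- m.+2 <= indep_prob m.+1.
  case: e => [|e]; first by rewrite /indep_prob big_ord0; lra.
  by apply: lt_le_trans (h e); rewrite ltrDl invr_gt0 exprn_gt0.
elim: m => [|m IHm]; rewrite /indep_prob big_ord_recr /=.
  by rewrite big_ord0 !exprS expr0; lra.
have y0 : 0 < 2 ^- m.+2 :> R by rewrite invr_gt0 exprn_gt0.
have y1 : 2 ^- m.+2 <= 1 / 4 :> R.
  rewrite div1r lef_pV2 ?posrE ?exprn_gt0 // (_ : 4 = 2 ^+ 2); last by ring.
  by rewrite ler_eXn2l // ltr1n.
have -> : 2 ^- m.+3 = 2 ^- m.+2 / 2 :> R by rewrite [in LHS]exprS invfM mulrC.
rewrite -/(indep_prob m.+1).
move: (2 ^- m.+2) (indep_prob m.+1) y0 y1 IHm => y p y0 y1 IHm.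
have := @ler_wpM2r R (1 - y) _ _ _ IHm; rewrite subr_ge0 => /(_ _); nra.
Qed.

Lemma indep_prob_ge0 (e : nat) : 0 <= indep_prob e.
Proof. by apply: le_trans (ltW (indep_prob_gt e)); lra. Qed.

Lemma indep_prob_le1 (e : nat) : indep_prob e <= 1.
Proof.
rewrite /indep_prob; apply: prodr_ile1 => i _.
rewrite gerBl invr_ge0 exprn_ge0 // subr_ge0 invf_le1 ?exprn_gt0 //.
by rewrite exprn_ege1 // ler1n.
Qed.

(** For k = 0 this is the minimum distance. For exact degree e + 1, a random direction avoids the
    degree-lowering subgroup with probability at least 1 - 2^-(e+1), the last factor of
    [indep_prob e.+1], and then the derivative has exact degree e. *)
Lemma rej_exact_degree (k n e : nat) (f : F2vec n -> 'F_2) :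
  (k <= e)%N -> vanish e.+1 f -> ~~ vanish e f ->
  2 ^- (e - k) * indep_prob e <= rej k f.
Proof.
elim: k e f => [|k IHk] e f ke vf nvf.
  have [x fx] : exists x, f x != 0.
    apply/existsP; apply: contraNT nvf => /existsPn f0.
    by apply/(vanish_leq (leq0n _))/vanish0P => x; apply/eqP; rewrite -[_ == _]negbK f0.
  have := @min_dist n e f setT x vf fx (fun _ _ _ _ => in_setT _).
  rewrite cardsT card_F2vec => h.
  have {h} h : (2 ^ n <= 2 ^ e * #|odd_cubes 0 f|)%N.
    apply: leq_trans h _; rewrite leq_mul2l card_odd_cubes0; apply/orP; right.
    rewrite -[leqLHS](card_imset _ (addrI x)); apply/subset_leq_card/subsetP => y.
    by case/imsetP => w; rewrite !inE => fw ->.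
  rewrite subn0 /rej muln1; apply: (@le_trans _ _ (2 ^- e)).
    by rewrite ler_piMr ?invr_ge0 ?exprn_ge0 ?indep_prob_le1.
  rewrite ler_pdivlMr ?exprn_gt0 // mulrC ler_pdivrMr ?exprn_gt0 //.
  by rewrite mulrC -!natrX -natrM ler_nat.
case: e ke vf nvf => // e ke /vanishSP vf nvf.
rewrite rejS subSS ler_pdivlMr ?exprn_gt0 //.
set W := [set v | vanish e (dirder v f)].
have low : (#|W| * 2 ^ e.+1 <= 2 ^ n)%N := card_low_directions nvf.
rewrite (bigID (mem (~: W))) /= -[leLHS]addr0; apply: lerD; last first.
  by apply: sumr_ge0 => v _; apply: rej_ge0.
apply: (@le_trans _ _ (\sum_(v in ~: W) 2 ^- (e - k) * indep_prob e)).
  rewrite sumr_const -[leRHS]mulr_natr /indep_prob big_ord_recr /= -/(indep_prob e).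
  rewrite -!mulrA; do 2!(rewrite ler_wpM2l ?invr_ge0 ?exprn_ge0 ?indep_prob_ge0 //).
  rewrite cardsCs setCK card_F2vec natrB ?natrX; last first.
    by apply: leq_trans low; rewrite leq_pmulr ?expn_gt0.
  rewrite mulrBl mul1r lerB // mulrC ler_pdivlMr ?exprn_gt0 //.
  by rewrite -!natrX -natrM ler_nat.
apply: ler_sum => v; rewrite !inE => nv; exact: IHk.
Qed.
End Rejection.

(** * Degenerate parallelepipeds and existence of the exact degree *)

(** If w M = 0 with w nonzero, the vertices of u and u + w coincide, so the terms cancel in pairs; a
    coordinate i with w_i = 1 picks one vertex from each pair. *)
Lemma cubesum_not_free (k n : nat) (f : F2vec n -> 'F_2) a (M : 'M_(k, n)) :
  ~~ row_free M -> cubesum f a M = 0.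
Proof.
rewrite -kermx_eq0 => /rowV0Pn[w]; rewrite sub_kermx => /eqP wM w0.
have [i wi] : exists i, w 0 i = 1.
  have /rV0Pn[i /F2_neq0 wi] := w0.
  by exists i.
rewrite /cubesum (bigID (fun u : F2vec k => u 0 i == 0)) /=.
rewrite [X in _ + X](reindex_inj (addrI w)) /=.
rewrite [X in _ + X](eq_big (fun u : F2vec k => u 0 i == 0) (fun u => f (a + u *m M))).
- by rewrite F2_addxx.
- by move=> u; rewrite mxE wi; case: (F2_cases (u 0 i)) => ->.
- by move=> u _; rewrite mulmxDl wM add0r.
Qed.

Lemma vanish_dim (n : nat) (f : F2vec n -> 'F_2) : vanish n.+1 f.
Proof.
apply/vanish_cubesumP => a M; apply: cubesum_not_free.
by rewrite /row_free neq_ltn ltnS rank_leq_col.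
Qed.

Lemma exact_degree (n k : nat) (f : F2vec n -> 'F_2) : ~~ vanish k f ->
  exists e, [/\ (k <= e)%N, (e <= n)%N, vanish e.+1 f & ~~ vanish e f].
Proof.
move=> nvf; have ex : exists e, vanish e.+1 f by exists n; apply: vanish_dim.
case: (ex_minnP ex) => e ve emin; exists e; split => //.
- by rewrite -ltnS ltnNge; apply: contraNN nvf => ek; apply: vanish_leq ve.
- by apply: emin; apply: vanish_dim.
- apply/negP => v0; case: e ve emin v0 => [|e] _ emin v0; last by have := emin e v0; rewrite ltnn.
  by rewrite (vanish_leq _ v0) in nvf.
Qed.

(** * Second moment of the number of errors on a parallelepiped *)

Lemma cubesum_vanish_add (n k : nat) (f P : F2vec n -> 'F_2) a (M : 'M_(k, n)) :
  vanish k P -> cubesum f a M = (#|[set u : F2vec k | f (a + u *m M) != P (a + u *m M)]|)%:R.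
Proof.
move/vanish_cubesumP/(_ a M) => SP.
rewrite -[LHS]addr0 -{}SP /cubesum -big_split -sum1_card natr_sum [RHS]big_mkcond /=.
apply: eq_bigr => u _; rewrite inE -F2_addr_eq0.
by case: (F2_cases (f (a + u *m M) + P (a + u *m M))) => ->.
Qed.

(** The fibres of M -> w M are translates of each other by values of [h], so w M is uniformly
    distributed. *)
Lemma card_mulmx_fiber (k n : nat) (w : F2vec k) (y : F2vec n) : w != 0 ->
  (#|[set M : 'M['F_2]_(k, n) | w *m M == y]| * 2 ^ n = 2 ^ (k * n))%N.
Proof.
case/rV0Pn => i /F2_neq0 wi.
pose h (z : F2vec n) : 'M['F_2]_(k, n) := delta_mx i 0 *m z.
have wh z : w *m h z = z.
  by rewrite mulmxA -colE [col i w]mx11_scalar mxE wi mul1mx.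
have fib (z : F2vec n) : #|[set M : 'M['F_2]_(k, n) | w *m M == z]| = #|[set M : 'M['F_2]_(k, n) | w *m M == y]|.
  rewrite -[LHS](card_imset _ (addrI (h (z + y)))); apply: eq_card => M.
  apply/imsetP/idP => [[M'] | ]; rewrite !inE.
    by move=> /eqP wM' ->; rewrite mulmxDr wh wM' addrAC F2mx_addxx add0r.
  move/eqP => wM; exists (M + h (z + y)); last by rewrite addrC F2mx_addK.
  by rewrite inE mulmxDr wh wM addrCA F2mx_addxx addr0.
rewrite -(card_F2mx k n) -[RHS]sum1_card (partition_big (mulmx w) predT) //=.
have cst (z : F2vec n) : true -> (\sum_(M | w *m M == z) 1 =
    #|[set M : 'M['F_2]_(k, n) | w *m M == y]|)%N by rewrite -(fib z) -sum1dep_card.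
by under eq_bigr => z _ do rewrite cst //; rewrite sum_nat_const card_F2vec mulnC.
Qed.

(** The difference (u + u') M is uniform and independent of the first vertex, so two distinct
    vertices are independent and uniform. *)
Lemma card_pair_hits (k n : nat) (E : {set F2vec n}) (u u' : F2vec k) : u != u' ->
  (#|[set p : F2vec n * 'M['F_2]_(k, n) |
       (affine_map p.1 p.2 u \in E) && (affine_map p.1 p.2 u' \in E)]| * 2 ^ n
   = #|E| ^ 2 * 2 ^ (k * n))%N.
Proof.
move=> uu'; have w0 : u + u' != 0 by apply: contraNN uu' => /eqP e; rewrite -[u](F2mx_addK _ u') e add0r.
have -> : #|[set p : F2vec n * 'M['F_2]_(k, n) |
       (affine_map p.1 p.2 u \in E) && (affine_map p.1 p.2 u' \in E)]| =
    (\sum_(x in E) \sum_(y in E) #|[set M : 'M['F_2]_(k, n) | (u + u') *m M == (x + y)%R]|)%N.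
  rewrite -sum1dep_card big_mkcond /=.
  rewrite -(pair_bigA _ (fun a M => if (affine_map a M u \in E) && (affine_map a M u' \in E)
                                    then 1 else 0))%N /=.
  rewrite exchange_big /=.
  have shift (M : 'M_(k, n)) : true ->
      (\sum_a (if (affine_map a M u \in E) && (affine_map a M u' \in E) then 1 else 0) =
       \sum_(x in E) ((x + (u + u') *m M)%R \in E))%N.
    move=> _; rewrite (reindex_inj (addIr (u *m M))) [RHS]big_mkcond /=.
    apply: eq_bigr => x _; rewrite /affine_map F2mx_addK mulmxDl addrA.
    by case: (x \in E) => //=; case: ifP.
  rewrite (eq_bigr _ shift) exchange_big /=; apply: eq_bigr => x xE.
  rewrite -(eq_bigr _ (fun y _ => sum1dep_card _)).
  under [RHS]eq_bigr do rewrite big_mkcond.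
  rewrite exchange_big /=; apply: eq_bigr => M _.
  have [yE|yE] := boolP (x + (u + u') *m M \in E).
    rewrite (bigD1 _ yE) /= addrA F2mx_addxx add0r eqxx big1 // => y /andP[_ ny].
    case: eqP => // e; case/eqP: ny; by rewrite e addrA F2mx_addxx add0r.
  rewrite big1 // => y yE'; case: eqP => // e.
  by case/negP: yE; rewrite e addrA F2mx_addxx add0r.
rewrite big_distrl /= -mulnn -mulnA -sum_nat_const; apply: eq_bigr => x _.
rewrite big_distrl /= -sum_nat_const; apply: eq_bigr => y _.
exact: card_mulmx_fiber.
Qed.

Lemma sum_hits (k n : nat) (E : {set F2vec n}) (u : F2vec k) :
  #|[set p : F2vec n * 'M['F_2]_(k, n) | affine_map p.1 p.2 u \in E]| = (#|E| * 2 ^ (k * n))%N.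
Proof.
have inj : injective (fun p : F2vec n * 'M['F_2]_(k, n) => (p.1 + u *m p.2, p.2)).
  by move=> [a M] [a' M'] [e eM]; move: e; rewrite eM => /addIr ->.
rewrite -(card_F2mx k n) -cardsT -cardsX -[LHS](card_imset _ inj).
apply: eq_card => -[x M]; rewrite !inE andbT; apply/imsetP/idP => [[[a M']]|xE].
  by rewrite inE /= => aE [-> _].
by exists (x + u *m M, M); rewrite ?inE /affine_map /= F2mx_addK.
Qed.

Lemma odd_cubes_hits (k n : nat) (f P : F2vec n -> 'F_2) (E : {set F2vec n}) :
  vanish k P -> E = [set x | f x != P x] ->
  (2 ^ k * #|E| * 2 ^ (k * n) * 2 ^ n <=
     #|odd_cubes k f| * 2 ^ n + (2 ^ k) ^ 2 * (#|E| ^ 2 * 2 ^ (k * n)))%N.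
Proof.
move=> vP EE.
pose X (p : F2vec n * 'M['F_2]_(k, n)) := #|[set u : F2vec k | affine_map p.1 p.2 u \in E]|.
(* X - X(X - 1) is 1 for X = 1 and at most 0 for every other natural number X, so it is a lower
   bound for the indicator of odd X. *)
have odd1 p : (X p <= (p \in odd_cubes k f) + X p * (X p).-1)%N.
  rewrite inE (cubesum_vanish_add _ _ _ vP).
  have -> : #|[set u : F2vec k | f (affine_map p.1 p.2 u) != P (affine_map p.1 p.2 u)]| = X p.
    by apply: eq_card => u; rewrite !inE EE inE.
  case: (X p) => [|[|m]] //=; rewrite mulSn; lia.
have sumX : (\sum_p X p = 2 ^ k * (#|E| * 2 ^ (k * n)))%N.
  rewrite /X; under eq_bigr do rewrite -sum1dep_card big_mkcond.
  rewrite exchange_big /=; under eq_bigr => u _ do rewrite -big_mkcond sum1dep_card sum_hits.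
  by rewrite sum_nat_const card_F2vec.
have sumXX : (\sum_p X p * (X p).-1 =
    \sum_(u : F2vec k) \sum_(u' | u != u')
      #|[set p : F2vec n * 'M['F_2]_(k, n) | (affine_map p.1 p.2 u \in E) && (affine_map p.1 p.2 u' \in E)]|)%N.
  transitivity (\sum_(p : F2vec n * 'M['F_2]_(k, n)) \sum_(u : F2vec k) \sum_(u' | u != u')
      ((affine_map p.1 p.2 u \in E) && (affine_map p.1 p.2 u' \in E) : nat))%N.
    apply: eq_bigr => p _; rewrite {1}/X -sum1dep_card big_distrl big_mkcond /=.
    apply: eq_bigr => u _; case: ifP => uE; last by rewrite big1.
    rewrite mul1n /X (cardsD1 u) inE uE add1n /= -sum1_card [LHS]big_mkcond [RHS]big_mkcond.
    apply: eq_bigr => u' _; rewrite !inE eq_sym.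
    by case: eqP => //= _; case: ifP.
  rewrite exchange_big /=; apply: eq_bigr => u _; rewrite exchange_big /=.
  by apply: eq_bigr => u' _; rewrite -sum1dep_card [RHS]big_mkcond /=; apply: eq_bigr => p _; case: ifP.
have : (\sum_p X p <= #|odd_cubes k f| + \sum_p X p * (X p).-1)%N.
  have -> : #|odd_cubes k f| = (\sum_p (p \in odd_cubes k f))%N.
    by rewrite -sum1_card [LHS]big_mkcond; apply: eq_bigr => p _; case: ifP.
  by rewrite -big_split; apply: leq_sum.
rewrite sumX sumXX -(leq_pmul2r (expn_gt0 2 n : (0 < 2 ^ n)%N)) => h.
rewrite mulnA in h; apply: leq_trans h _; rewrite mulnDl leq_add2l big_distrl /=.
apply: (@leq_trans (\sum_(u : F2vec k) 2 ^ k * (#|E| ^ 2 * 2 ^ (k * n)))%N); last first.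
  by rewrite sum_nat_const card_F2vec mulnA.
apply: leq_sum => u _; rewrite big_distrl /=.
under eq_bigr => u' uu' do rewrite card_pair_hits //.
rewrite sum_nat_const leq_mul2r -(card_F2vec k) max_card orbT //.
Qed.

Section Rejection.
Variable R : realFieldType.

(** Here t is the expected number of errors among the 2^k vertices, and t^2 bounds the expectation
    of X(X - 1). *)
Lemma rej_second_moment (k n : nat) (f P : F2vec n -> 'F_2) (t : R) :
  vanish k P -> t = 2 ^+ k * (#|[set x | f x != P x]|%:R / 2 ^+ n) ->
  t * (1 - t) <= rej R k f.
Proof.
move=> vP tE; set E := [set x | _] in tE; have h := odd_cubes_hits vP (erefl E).
rewrite /rej ler_pdivlMr ?exprn_gt0 //.
have : (2 ^ k * #|E| * 2 ^ (k * n) * 2 ^ n)%:R <=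
  (#|odd_cubes k f| * 2 ^ n + (2 ^ k) ^ 2 * (#|E| ^ 2 * 2 ^ (k * n)))%:R :> R by rewrite ler_nat.
rewrite !(natrM, natrD, natrX).
have -> : #|E|%:R = t * 2 ^- k * 2 ^+ n :> R.
  by rewrite tE; field; rewrite !expf_neq0 ?pnatr_eq0.
rewrite mulnSr exprD [(n * k)%N]mulnC.
have := exprn_gt0 n (ltr0n R 2 : 0 < 2); have := exprn_gt0 k (ltr0n R 2 : 0 < 2).
have := exprn_gt0 (k * n) (ltr0n R 2 : 0 < 2).
move: (2 ^+ n) (2 ^+ k) (2 ^+ (k * n)) => x y z z0 y0 x0.
move=> hh; rewrite -(ler_pM2r x0); apply: le_trans (_ : t * z * x * x - t ^+ 2 * z * x * x <= _); first by lra.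
move: hh.
have -> : y * (t * y^-1 * x) * z * x = t * z * x * x by field; rewrite gt_eqF.
have -> : y ^+ 2 * ((t * y^-1 * x) ^+ 2 * z) = t ^+ 2 * z * x * x by field; rewrite gt_eqF.
lra.
Qed.
End Rejection.

(** * Hyperplanes and gluing of polynomials *)

Definition dot (n : nat) (x c : F2vec n) : 'F_2 := (x *m c^T) 0 0.

Lemma dotDl (n : nat) (x y c : F2vec n) : dot (x + y) c = dot x c + dot y c.
Proof. by rewrite /dot mulmxDl mxE. Qed.

Lemma dotDr (n : nat) (x c c' : F2vec n) : dot x (c + c') = dot x c + dot x c'.
Proof. by rewrite /dot linearD /= mulmxDr mxE. Qed.

Lemma dotZl (n : nat) a (x c : F2vec n) : dot (a *: x) c = a * dot x c.
Proof. by rewrite /dot -scalemxAl mxE. Qed.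

Lemma F2_neq_add1 (x y : 'F_2) : x != y -> x + 1 = y.
Proof. by case: (F2_cases x) => ->; case: (F2_cases y) => -> // _; apply: val_inj. Qed.

Lemma F2_eq_add1 (x : 'F_2) : (x + 1 == x) = false.
Proof. by case: (F2_cases x) => ->. Qed.

Lemma dot_separate (l n : nat) (C : 'M['F_2]_(l, n)) (c : F2vec n) : ~~ (c <= C)%MS ->
  exists e, (forall i, dot e (row i C) = 0) /\ dot e c = 1.
Proof.
rewrite submxE => /rV0Pn[j /F2_neq0 cj].
have dotE m (A : 'M_(m, n)) i : dot (col j (cokermx C))^T (row i A) = (A *m cokermx C) i j.
  by rewrite /dot !mxE; apply: eq_bigr => k _; rewrite !mxE mulrC.
exists (col j (cokermx C))^T; split=> [i|]; first by rewrite dotE mulmx_coker mxE.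
by rewrite -cj -dotE; congr dot; apply/rowP => k; rewrite mxE.
Qed.

Lemma dot_neq0 (n : nat) (c : F2vec n) : c != 0 -> exists e, dot e c = 1.
Proof.
move=> c0; have [|e [_ ce]] := @dot_separate 0 n 0 c; last by exists e.
by apply: contraNN c0 => /submx0null->.
Qed.

(** Two linear conditions lower the dimension by at most 2; c = c' is allowed, and is used for a
    single hyperplane. *)
Lemma card_dot2_kernel_ge (n : nat) (c c' : F2vec n) :
  (2 ^ n <= 4 * #|[set w | (dot w c == 0%R) && (dot w c' == 0%R)]|)%N.
Proof.
have -> : [set w | (dot w c == 0) && (dot w c' == 0)] =
          [set w | w *m row_mx c^T c'^T == 0].
  apply/setP => w; rewrite !inE mul_mx_row -[RHS]/(_ == 0).
  apply/andP/eqP => [[/eqP wc /eqP wc']|/eqP].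
    apply/rowP => i; rewrite [RHS]mxE -(splitK i); case: (split i) => j /=.
      by rewrite row_mxEl ord1 -[RHS]wc.
    by rewrite row_mxEr ord1 -[RHS]wc'.
  rewrite -[0]row_mx0 => /eqP/eq_row_mx[wc wc'].
  by rewrite /dot wc wc' mxE.
rewrite card_kernel (_ : 4 = 2 ^ 2)%N // -expnD leq_exp2l //.
by have := rank_leq_col (row_mx c^T c'^T); lia.
Qed.

(** If P + P' were nonzero at a point of the intersection, it would be nonzero at 2^(n-d-2) or more
    points there, by the minimum distance. Each is an error of P or of P', and there are at most
    2^(n-d-4) of these. *)
Lemma close_agree (n d : nat) (f P P' : F2vec n -> 'F_2) (c c' : F2vec n) b b' :
  vanish d.+1 P -> vanish d.+1 P' ->
  (#|[set x | (dot x c == b) && (f x != P x)]| * 2 ^ (d + 5) <= 2 ^ n)%N ->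
  (#|[set x | (dot x c' == b') && (f x != P' x)]| * 2 ^ (d + 5) <= 2 ^ n)%N ->
  forall x, dot x c = b -> dot x c' = b' -> P x = P' x.
Proof.
move=> vP vP'; set A := [set x | _]; set A' := [set x | _] => cA cA' x xc xc'.
apply/eqP; rewrite -F2_addr_eq0; apply: contraT => gx.
pose W := [set w | (dot w c == 0) && (dot w c' == 0)].
have addW : {in W &, forall u v, u + v \in W}.
  move=> u v; rewrite !inE !dotDl => /andP[/eqP-> /eqP->] /andP[/eqP-> /eqP->].
  by rewrite addr0.
have := min_dist (vanishD vP vP') gx addW.
set Z := [set w in W | _] => h1.
have h2 : (#|Z| <= #|A| + #|A'|)%N.
  apply: leq_trans (leq_card_setU _ _); rewrite -[leqLHS](card_imset _ (addrI x)).
  apply/subset_leq_card/subsetP => _ /imsetP[w + ->].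
  rewrite !inE !dotDl xc xc' => /andP[/andP[/eqP-> /eqP->]].
  rewrite F2_addr_eq0 addr0 addr0 !eqxx /=; apply: contraR.
  by rewrite negb_or !negbK => /andP[/eqP <- /eqP <-].
have h3 := card_dot2_kernel_ge c c'; rewrite -/W in h3.
have n0 : (0 < 2 ^ n)%N by rewrite expn_gt0.
have : (#|W| * 32 <= (#|A| + #|A'|) * 2 ^ (d + 5))%N.
  apply: (@leq_trans (2 ^ d * #|Z| * 32)); first by rewrite leq_mul2r h1 orbT.
  rewrite expnD [leqRHS]mulnCA -mulnA leq_mul2l; apply/orP; right.
  by rewrite -[(2 ^ 5)%N]/32%N; move: h2; clear; lia.
rewrite mulnDl; move: h3 cA cA' n0; clear; move: (2 ^ (d + 5))%N (2 ^ n)%N => p q; lia.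
Qed.

(* The independent functionals are met one at a time: if e separates c from the
   previous ones, x + (c.x + b c) e projects onto the hyperplane of c and
   preserves the previous hyperplanes. *)
Lemma glue (n d l : nat) (G : {set F2vec n})
    (b : F2vec n -> 'F_2) (P : F2vec n -> F2vec n -> 'F_2) :
  {in G, forall c, vanish d.+1 (P c)} ->
  {in G &, forall c c' x, dot x c = b c -> dot x c' = b c' -> P c x = P c' x} ->
  (2 ^ l <= #|G|)%N ->
  exists (C : 'M_(l, n)) (Q : F2vec n -> 'F_2), [/\ vanish d.+1 Q,
    forall i, row i C \in G,
    forall i x, dot x (row i C) = b (row i C) -> Q x = P (row i C) x
    & (#|[set x | [forall i, dot x (row i C) != b (row i C)]]| * 2 ^ l <= 2 ^ n)%N].
Proof.
move=> vP agree; elim: l => [|l IHl] Gl.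
  exists 0, (fun=> 0); split; try by case.
    exact: vanish_zero.
  by rewrite muln1 -card_F2vec max_card.
have [|C [Q [vQ CG QP cU]]] := IHl; first by apply: leq_trans Gl; rewrite leq_exp2l.
(* The l rows of C span at most 2^l vectors, fewer than G has. *)
have [c cG cC] : exists2 c, c \in G & ~~ (c <= C)%MS.
  apply/exists_inP; apply: contraLR Gl; rewrite negb_exists_in => /forall_inP GC.
  rewrite -ltnNge; apply: (@leq_ltn_trans #|rowg C|).
    apply/subset_leq_card/subsetP => c /GC; rewrite negbK inE; exact.
  by rewrite card_rowg card_Fp // ltn_exp2l // ltnS rank_leq_row.
have [e [eC ec]] := dot_separate cC.
pose pi x := x + (dot x c + b c) *: e.
have pic x : dot (pi x) c = b c.
  by rewrite /pi dotDl dotZl ec mulr1 addrA F2_addxx add0r.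
have piC x i : dot (pi x) (row i C) = dot x (row i C).
  by rewrite /pi dotDl dotZl eC mulr0 addr0.
have pix x : dot x c = b c -> pi x = x by move=> xc; rewrite /pi xc F2_addxx scale0r addr0.
have vpi g : vanish d.+1 g -> vanish d.+1 (fun x => g (pi x)).
  move/(vanish_affine (b c *: e) (1%:M + c^T *m e)); congr (is_true _).
  apply: eq_vanish => x; congr g.
  rewrite /pi mulmxDr mulmx1 mulmxA [x *m c^T]mx11_scalar mul_scalar_mx scalerDl.
  by rewrite addrC -addrA.
pose C' : 'M_(1 + l, n) := col_mx c C.
have rowC' i : row i C' = c \/ exists j, row i C' = row j C.
  rewrite -(splitK i); case: (split i) => j; last by right; exists j; rewrite rowKd.
  by left; rewrite rowKu; apply/rowP => k; rewrite mxE ord1.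
have cC' : row (lshift l (ord0 : 'I_1)) C' = c by rewrite rowKu; apply/rowP => k; rewrite mxE.
have CC' i : row (rshift 1 i) C' = row i C by rewrite rowKd.
(* On the new hyperplane [pi] is the identity, so this equals P_c. On an earlier one the correction
   is 0, because [pi] lands in its intersection with the new one, where Q and P_c agree. *)
exists C', (fun x => Q x + (P c (pi x) + Q (pi x))); split.
- by apply/vanishD/vanishD => //; apply: vpi => //; apply: vP.
- by move=> i; case: (rowC' i) => [->|[j ->]].
- move=> i x; case: (rowC' i) => [->|[j ->]] xi.
    by rewrite pix // addrC F2_addK.
  rewrite -(QP j) // (QP j (pi x)) ?piC // (agree _ _ cG (CG j)) ?piC //.
  by rewrite F2_addxx addr0.
set U' := [set x | _]; set U := [set x | _] in cU.
(* Translation by e keeps a point off the earlier hyperplanes but changes its side of the new one,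
   so at least half of the uncovered points become covered. *)
apply: leq_trans cU; rewrite expnS mulnA leq_mul2r; apply/orP; right.
have inU' x : x \in U' -> (x \in U) && (dot x c != b c).
  rewrite !inE => /forallP xU'; have := xU' (lshift l (ord0 : 'I_1)).
  rewrite cC' => ->; rewrite andbT.
  by apply/forallP => i; rewrite -CC'.
apply: (double_card_leq (addIr e)).
- by apply/subsetP => x /inU'/andP[].
- move=> x /inU'/andP[]; rewrite !inE => /forallP xU _; apply/forallP => i.
  by rewrite dotDl eC addr0.
- move=> x /inU'/andP[_ xc]; apply/negP => /inU'/andP[_].
  by rewrite dotDl ec (F2_neq_add1 xc) eqxx.
Qed.

(** Gluing along d + 3 independent hyperplanes leaves at most 2^(n-d-3) points uncovered. On any
    other hyperplane of G, Q and P_c can differ only at uncovered points, whereas the minimum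
    distance would give at least 2^(n-d-2) differences. *)
Lemma glue_all (n d : nat) (f : F2vec n -> 'F_2) (G : {set F2vec n})
    (b : F2vec n -> 'F_2) (P : F2vec n -> F2vec n -> 'F_2) :
  {in G, forall c, vanish d.+1 (P c)} ->
  {in G, forall c, #|[set x | (dot x c == b c) && (f x != P c x)]| * 2 ^ (d + 5) <= 2 ^ n}%N ->
  (2 ^ (d + 6) <= #|G|)%N ->
  exists Q : F2vec n -> 'F_2, vanish d.+1 Q /\
    {in G, forall c x, dot x c = b c -> Q x = P c x}.
Proof.
move=> vP cP Gd.
have agree : {in G &, forall c c' x, dot x c = b c -> dot x c' = b c' -> P c x = P c' x}.
  by move=> c c' cG c'G; apply: close_agree (vP _ cG) (vP _ c'G) (cP _ cG) (cP _ c'G).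
have [|C [Q [vQ CG QP cU]]] := @glue n d d.+3 G b P vP agree.
  by apply: leq_trans Gd; rewrite leq_exp2l //; lia.
exists Q; split=> // c cG x xc; apply/eqP; rewrite -F2_addr_eq0; apply: contraT => gx.
pose W := [set w | (dot w c == 0) && (dot w c == 0)].
have addW : {in W &, forall u v, u + v \in W}.
  by move=> u v; rewrite !inE !dotDl !andbb => /eqP-> /eqP->; rewrite addr0.
have := min_dist (vanishD vQ (vP _ cG)) gx addW.
set Z := [set w in W | _] => h1; set U := [set x | _] in cU.
have h2 : (#|Z| <= #|U|)%N.
  rewrite -[leqLHS](card_imset _ (addrI x)).
  apply/subset_leq_card/subsetP => _ /imsetP[w + ->].
  rewrite !inE andbb => /andP[/eqP wc ne]; apply/forallP => i.
  apply: contraNN ne => /eqP wi; rewrite F2_addr_eq0 (QP i) //.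
  by apply/eqP; apply: agree => //; rewrite dotDl xc wc addr0.
have h3 := card_dot2_kernel_ge c c; rewrite -/W in h3.
have n0 : (0 < 2 ^ n)%N by rewrite expn_gt0.
have : (#|W| * 8 <= #|U| * 2 ^ d.+3)%N.
  apply: (@leq_trans (2 ^ d * #|Z| * 8)); first by rewrite leq_mul2r h1 orbT.
  by rewrite -[d.+3]addn3 expnD [leqRHS]mulnCA -mulnA leq_mul2l leq_mul2r h2 !orbT.
by move: h3 cU n0; clear; move: (2 ^ d.+3)%N (2 ^ n)%N => p q; lia.
Qed.

(** * Almost every point lies on many hyperplanes *)

Definition hits (n : nat) (G : {set F2vec n}) (b : F2vec n -> 'F_2) x :=
  #|[set c in G | dot x c == b c]|.

(** A sign character up to a global sign, so that distinct c give orthogonal functions of x. *)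
Definition side (n : nat) (b : F2vec n -> 'F_2) c x : int :=
  if dot x c == b c then 1 else -1.

Lemma side_sum (n : nat) (G : {set F2vec n}) b x :
  \sum_(c in G) side b c x = (hits G b x)%:Z * 2 - #|G|%:Z.
Proof.
have -> : (hits G b x)%:Z = \sum_(c in G) (dot x c == b c)%:R.
  rewrite /hits -sum1_card -natz natr_sum [LHS]big_mkcond [RHS]big_mkcond /=.
  by apply: eq_bigr => c _; rewrite inE; case: (c \in G) => //=; case: eqP.
rewrite -sum1_card -natz natr_sum big_distrl -sumrB /=.
by apply: eq_bigr => c _; rewrite /side; case: eqP.
Qed.

(** For c different from c', a translation by e with e.(c + c') = 1 flips exactly one of the two
    signs, so the sum equals its own negative. *)
Lemma side_orth (n : nat) (b : F2vec n -> 'F_2) c c' :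
  \sum_x side b c x * side b c' x = if c == c' then 2 ^+ n else 0.
Proof.
case: eqVneq => [->|ne].
  rewrite (eq_bigr (fun=> 1)) => [|x _]; last by rewrite /side; case: eqP.
  by rewrite sumr_const card_F2vec natrX.
have [|e] := @dot_neq0 n (c + c').
  by apply: contraNN ne => /eqP e; rewrite -[c](F2mx_addK _ c') e add0r.
rewrite dotDr => ecc.
suff : \sum_x side b c x * side b c' x = - \sum_x side b c x * side b c' x by lia.
rewrite {1}(reindex_inj (addIr e)) -sumrN /=; apply: eq_bigr => x _.
have flip u v : side b u (x + v) = if dot v u == 0 then side b u x else - side b u x.
  rewrite /side dotDl; case: (F2_cases (dot v u)) => ->; first by rewrite addr0.
  rewrite /=; case: (eqVneq (dot x u) (b u)) => [<-|/F2_neq_add1->].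
    by rewrite F2_eq_add1.
  by rewrite eqxx.
rewrite !flip; move: ecc; case: (F2_cases (dot e c)) => ->; case: (F2_cases (dot e c')) => -> //= _.
  by rewrite mulrN.
by rewrite mulNr.
Qed.

(** Chebyshev: by orthogonality the sum of the signs, 2 hits - |G|, has mean square |G|, while at a
    rarely hit point its absolute value is at least |G|/3. *)
Lemma card_rarely_hit (n : nat) (G : {set F2vec n}) b :
  (#|[set x | 3 * hits G b x <= #|G|]| * #|G| <= 9 * 2 ^ n)%N.
Proof.
set B := [set x | _]; have [->|G0] := posnP #|G|; first by rewrite muln0.
have var : \sum_x (\sum_(c in G) side b c x) ^+ 2 = (#|G| * 2 ^ n)%:Z.
  under eq_bigr do rewrite expr2 big_distrl /=.
  rewrite exchange_big /=.
  rewrite PoszM -[Posz (2 ^ n)]natz -[Posz #|G|]natz mulr_natl -sumr_const.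
  apply: eq_bigr => c cG; under eq_bigr do rewrite big_distrr /=.
  rewrite exchange_big /= (bigD1 c) //= side_orth eqxx big1 ?addr0.
    by rewrite natrX.
  by move=> c' /andP[_ ne]; rewrite side_orth eq_sym (negbTE ne).
have : (#|B| * #|G| ^ 2)%:Z <= 9 * \sum_x (\sum_(c in G) side b c x) ^+ 2.
  rewrite mulr_sumr (bigID (mem B)) /= -[leLHS]addr0 lerD //; last first.
    by apply: sumr_ge0 => x _; rewrite mulr_ge0 ?sqr_ge0.
  rewrite PoszM -natz mulr_natl -sumr_const; apply: ler_sum => x; rewrite inE side_sum.
  move: (hits G b x) #|G| => a K aK; rewrite -mulnn.
  (* The product is the factored form of 9 (2a - K)^2 - K^2. *)
  have : (0 <= (2 * K%:Z - 6 * a%:Z) * (4 * K%:Z - 6 * a%:Z)) by rewrite mulr_ge0 //; lia.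
  by lia.
rewrite var -mulnn mulnA => h; rewrite -(leq_pmul2r G0); move: h; clear; lia.
Qed.

(** An error of Q at a point that is not rarely hit is an error of P_c for over |G|/3 of the c, so
    double counting leaves at most a fraction 3/32 of 2^-d of such points. The rarely hit points add
    at most 9/64 of 2^-d, and the total 15/64 is below 1/4. *)
Lemma close_of_hyperplanes (n d : nat) (f : F2vec n -> 'F_2) (G : {set F2vec n})
    (b : F2vec n -> 'F_2) (P : F2vec n -> F2vec n -> 'F_2) :
  {in G, forall c, vanish d.+1 (P c)} ->
  {in G, forall c, #|[set x | (dot x c == b c) && (f x != P c x)]| * 2 ^ (d + 5) <= 2 ^ n}%N ->
  (2 ^ (d + 6) <= #|G|)%N ->
  exists Q : F2vec n -> 'F_2, vanish d.+1 Q /\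
    (#|[set x | f x != Q x]| * 2 ^ (d + 2) <= 2 ^ n)%N.
Proof.
move=> vP cP Gd; have [Q [vQ QP]] := glue_all vP cP Gd.
exists Q; split=> //; set E := [set x | _].
set B := [set x | 3 * hits G b x <= #|G|]%N.
have hB := card_rarely_hit G b; rewrite -/B in hB.
have hE : (#|E :\: B| * #|G| <= 3 * \sum_(c in G) #|[set x | (dot x c == b c) && (f x != P c x)]|)%N.
  apply: (@leq_trans (\sum_(x in E :\: B) 3 * hits G b x)).
    rewrite -sum_nat_const; apply: leq_sum => x; rewrite !inE => /andP[+ _].
    by rewrite -ltnNge => /ltnW.
  rewrite -big_distrr leq_mul2l /=.
  under [leqRHS]eq_bigr do rewrite -sum1_card big_mkcond /=.
  rewrite exchange_big /= big_mkcond; apply: leq_sum => x _.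
  case: ifP => //; rewrite !inE => /andP[_ fQ].
  rewrite /hits -sum1_card big_mkcond [leqRHS]big_mkcond /=; apply: leq_sum => c _.
  rewrite !inE; case: (boolP (c \in G)) => //= cG; case: eqP => //= xc.
  by rewrite -(QP _ cG _ xc) fQ.
have hsum : (\sum_(c in G) #|[set x | (dot x c == b c) && (f x != P c x)]| * 2 ^ (d + 5) <=
             #|G| * 2 ^ n)%N by rewrite -sum_nat_const; apply: leq_sum.
rewrite -big_distrl /= in hsum.
have G0 : (0 < #|G|)%N by apply: leq_trans Gd; rewrite expn_gt0.
have hED : (#|E :\: B| * 2 ^ (d + 5) <= 3 * 2 ^ n)%N.
  rewrite -(leq_pmul2r G0); move: hE hsum; move: (\sum_(c in G) _)%N (2 ^ (d + 5))%N => s q hE hsum.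
  rewrite mulnAC; apply: (@leq_trans (3 * s * q)); first by rewrite leq_mul2r hE orbT.
  by move: hsum; clear; move: (2 ^ n)%N #|G| => m K; nia.
have hBD : (#|B| * 2 ^ (d + 6) <= 9 * 2 ^ n)%N.
  by apply: leq_trans hB; rewrite leq_mul2l Gd orbT.
have hEB : (#|E| <= #|E :\: B| + #|B|)%N.
  by rewrite -(cardsID B E) addnC leq_add2l subset_leq_card // subsetIr.
have p2 k : (2 ^ (d + k) = 2 ^ d * 2 ^ k)%N by rewrite expnD.
rewrite !p2 in hBD hED *; move: hBD hED hEB; clear.
move: (2 ^ d)%N (2 ^ n)%N => q m; rewrite (_ : (2 ^ 6 = 64)%N) // (_ : (2 ^ 5 = 32)%N) //.
rewrite (_ : (2 ^ 2 = 4)%N) //; nia.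
Qed.

(** * Parallelepipeds inside hyperplanes *)

Lemma hyperplane_param (n : nat) (c : F2vec n.+1) b : c != 0 ->
  exists a (M : 'M_(n, n.+1)), [/\ row_free M, forall u, dot (affine_map a M u) c = b
    & forall x, dot x c = b -> exists u, x = affine_map a M u].
Proof.
move=> c0; have [e ec] := dot_neq0 c0.
have rK : \rank (kermx c^T) = n.
  by rewrite mxrank_ker mxrank_tr rank_rV c0 subn1.
have [M [Mfree MK]] : exists M : 'M_(n, n.+1), row_free M /\ (M :=: kermx c^T)%MS.
  move: (row_base (kermx c^T)) (row_base_free (kermx c^T)) (eq_row_base (kermx c^T)).
  by rewrite rK => M; exists M.
have dotM u : dot (u *m M) c = 0.
  have : (u *m M <= kermx c^T)%MS by rewrite -MK submxMl.
  by move/sub_kermxP; rewrite /dot => ->; rewrite mxE.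
exists (b *: e), M; split=> // [u|x xc].
  by rewrite /affine_map dotDl dotZl ec dotM mulr1 addr0.
have : ((x + b *: e)%R <= M)%MS.
  rewrite MK; apply/sub_kermxP; rewrite [LHS]mx11_scalar -/(dot _ _).
  by rewrite dotDl dotZl ec xc mulr1 F2_addxx raddf0.
by case/submxP => u xu; exists u; rewrite /affine_map addrC -xu F2mx_addK.
Qed.

Lemma cubesum_affine_map (k m n : nat) (f : F2vec n -> 'F_2) a (M : 'M_(m, n)) b (N : 'M_(k, m)) :
  cubesum (fun u => f (affine_map a M u)) b N = cubesum f (affine_map a M b) (N *m M).
Proof.
by apply: eq_bigr => u _; rewrite /affine_map mulmxDl mulmxA addrA.
Qed.

Definition cubes_in (k n : nat) f (c : F2vec n) (b : 'F_2) : {set F2vec n * 'M['F_2]_(k, n)} :=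
  [set p in odd_cubes k f | (dot p.1 c == b) && (p.2 *m c^T == 0)].

Lemma card_odd_cubes_hyperplane (k m n : nat) f (c : F2vec n) b a (M : 'M_(m, n)) :
  row_free M -> (forall u, dot (affine_map a M u) c = b) ->
  (#|odd_cubes k (fun u => f (affine_map a M u))| <= #|cubes_in k f c b|)%N.
Proof.
move=> Mfree ab.
have inj : injective (fun p : F2vec m * 'M['F_2]_(k, m) => (affine_map a M p.1, p.2 *m M)).
  move=> [u N] [u' N'] [/addrI eu eN].
  by rewrite (row_free_inj Mfree eu) (row_free_inj Mfree eN).
have dotM u : dot (u *m M) c = 0.
  have := ab u; rewrite -(ab 0) /affine_map mul0mx addr0 dotDl => /eqP.
  by rewrite -subr_eq0 addrAC subrr add0r => /eqP.
rewrite -[leqLHS](card_imset _ inj); apply/subset_leq_card/subsetP => _ /imsetP[[u N] + ->].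
rewrite !inE /= cubesum_affine_map => -> /=; rewrite ab eqxx /=.
apply/eqP/row_matrixP => i; rewrite row0 !row_mul; apply/rowP => j; rewrite ord1 [RHS]mxE.
exact: dotM.
Qed.

(** Double counting: an odd parallelepiped has independent directions, hence 2^(n-k) vectors c are
    orthogonal to all of them, c = 0 included, and for each the base point determines b. *)
Lemma sum_cubes_in (k n : nat) (f : F2vec n -> 'F_2) :
  (\sum_(c : F2vec n) \sum_b #|cubes_in k f c b| = #|odd_cubes k f| * 2 ^ (n - k))%N.
Proof.
transitivity (\sum_(c : F2vec n) \sum_(p in odd_cubes k f) (p.2 *m c^T == 0%R))%N.
  apply: eq_bigr => c _; under eq_bigr => b _.
    rewrite -sum1_card big_mkcond.
    rewrite (eq_bigr (fun p => if p \in odd_cubes k f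
      then ((dot p.1 c == b) && (p.2 *m c^T == 0%R) : nat) else 0%N)).
      over.
    by move=> p _; rewrite /cubes_in in_set; case: (p \in odd_cubes k f) => //=; case: ifP.
  rewrite exchange_big [RHS]big_mkcond /=; apply: eq_bigr => p _.
  case: ifP => _; last by rewrite big1.
  rewrite (bigD1 (dot p.1 c)) //= eqxx big1 ?addn0 // => b /negbTE.
  by rewrite eq_sym => ->.
rewrite exchange_big /= -sum_nat_const; apply: eq_bigr => -[a M]; rewrite inE /= => odd.
have Mfree : row_free M by apply: contraNT odd => /cubesum_not_free->.
transitivity #|[set c : F2vec n | c *m M^T == 0]|.
  rewrite -sum1_card [RHS]big_mkcond /=; apply: eq_bigr => c _; rewrite inE.
  by rewrite -[M]trmxK -trmx_mul trmx_eq0 trmxK; case: eqP.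
by rewrite card_kernel mxrank_tr (eqP Mfree).
Qed.

(** * Lower bound on the rejection probability, by induction on the dimension *)

Section Rejection.
Variable R : realFieldType.

(** The exact degree e is at most n, so e - d - 1 <= 7, and 2^-7 times 1/4 is 2^-9. *)
Lemma rej_small_dim (d n : nat) (f : F2vec n -> 'F_2) : (n <= d + 8)%N ->
  ~~ vanish d.+1 f -> 2 ^- 9 <= rej R d.+1 f.
Proof.
move=> nd /exact_degree[e [de en ve nve]].
apply: le_trans (rej_exact_degree R de ve nve).
apply: (@le_trans _ _ (2 ^- (e - d.+1) * (1 / 4))).
  rewrite (_ : 1 / 4 = 2 ^- 2); last by field.
  rewrite -invfM -exprD lef_pV2 ?posrE ?exprn_gt0 // ler_eXn2l ?ltr1n //; lia.
by rewrite ler_wpM2l ?invr_ge0 ?exprn_ge0 // ltW ?indep_prob_gt.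
Qed.

Definition far (d n : nat) (f : F2vec n -> 'F_2) : Prop :=
  forall P : F2vec n -> 'F_2, vanish d.+1 P -> (2 ^ n < #|[set x | f x != P x]| * 2 ^ (d + 4))%N.

Lemma far_nonvanish (d n : nat) (f : F2vec n -> 'F_2) : far d f -> ~~ vanish d.+1 f.
Proof.
move=> ff; apply/negP => /ff; rewrite (_ : [set x | _] = set0) ?cards0 //.
by apply/setP => x; rewrite !inE eqxx.
Qed.

(** The expected number t of errors on a parallelepiped lies between 1/8 and 1/2, so t(1 - t) >=
    1/16. *)
Lemma rej_mid_range (d n : nat) (f P : F2vec n -> 'F_2) : far d f -> vanish d.+1 P ->
  (#|[set x | f x != P x]| * 2 ^ (d + 2) <= 2 ^ n)%N -> 2 ^- 9 <= rej R d.+1 f.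
Proof.
move=> ff vP; have := ff P vP; set E := [set x | _] => lo hi.
apply: le_trans (rej_second_moment vP (erefl _)); rewrite -/E.
set y : R := #|E|%:R / 2 ^+ n.
have loR : 1 <= 8 * (2 ^+ d.+1 * y).
  have := ltnW lo; rewrite -(ler_nat R) natrM !natrX => h.
  rewrite /y mulrA mulrA ler_pdivlMr ?exprn_gt0 // mul1r.
  by apply: le_trans h _; rewrite le_eqVlt exprS exprD; apply/orP; left; apply/eqP; ring.
have hiR : 2 * (2 ^+ d.+1 * y) <= 1.
  move: hi; rewrite -(ler_nat R) natrM !natrX => h.
  rewrite /y mulrA mulrA ler_pdivrMr ?exprn_gt0 // mul1r.
  by apply: le_trans _ h; rewrite le_eqVlt exprS exprD; apply/orP; left; apply/eqP; ring.
move: (2 ^+ d.+1 * y) loR hiR => t; rewrite !exprS expr0; nra.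
Qed.

(** A hyperplane has 2^(n-1) points, so the exponent d + 5 means a relative distance of at most
    2^-(d+4) on it, the threshold of [far]. *)
Definition close_side (d n : nat) (f : F2vec n -> 'F_2) (c : F2vec n) : pred ('F_2 * boolfun n) :=
  fun q => vanish d.+1 q.2 &&
    (#|[set x | (dot x c == q.1) && (f x != q.2 x)]| * 2 ^ (d + 5) <= 2 ^ n)%N.

(** A polynomial P close to the restriction would extend, through the pseudo-inverse of M, to one of
    degree at most d on the whole space that is close to f on the hyperplane. *)
Lemma far_hyperplane (d n : nat) (f : F2vec n.+1 -> 'F_2) c b a (M : 'M_(n, n.+1)) :
  row_free M -> (forall x, dot x c = b -> exists u, x = affine_map a M u) ->
  ~~ [exists q, close_side d f c q] -> far d (fun u => f (affine_map a M u)).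
Proof.
move=> Mfree surj /existsPn nclose P vP.
have aK u : (affine_map a M u + a) *m pinvmx M = u.
  by rewrite /affine_map addrAC F2mx_addxx add0r mulmxKp.
have := nclose (b, [ffun x => P ((x + a) *m pinvmx M)]).
rewrite /close_side negb_and -ltnNge => /orP[/negP[]|/= h].
  rewrite (eq_vanish _ (g := fun x => P (a *m pinvmx M + x *m pinvmx M))).
    exact: vanish_affine.
  by move=> x; rewrite ffunE mulmxDl addrC.
rewrite -(ltn_pmul2r (isT : 0 < 2)%N) -mulnA -!expnSr -addnS.
apply: leq_trans h _; rewrite leq_mul2r; apply/orP; right.
pose h u := affine_map a M u.
apply: leq_trans (leq_imset_card h _); apply/subset_leq_card/subsetP => x.
rewrite !inE ffunE => /andP[/eqP/surj[u ->]]; rewrite aK => ne.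
by apply/imsetP; exists u; rewrite ?inE.
Qed.

Lemma card_close_side (d n : nat) (f : F2vec n -> 'F_2) :
  (forall P : F2vec n -> 'F_2, vanish d.+1 P ->
     2 ^ n < #|[set x | f x != P x]| * 2 ^ (d + 2))%N ->
  (#|[set c : F2vec n | [exists q, close_side d f c q]]| < 2 ^ (d + 6))%N.
Proof.
move=> nfar; rewrite ltnNge; apply/negP => Gd.
(* The default is never taken for c in the set under consideration. *)
pose q c := odflt (0, [ffun=> 0]) [pick q | close_side d f c q].
have qP : {in [set c : F2vec n | [exists q, close_side d f c q]], forall c, close_side d f c (q c)}.
  move=> c; rewrite inE => /existsP[q0 q0P]; rewrite /q.
  by case: pickP => [//|/(_ q0)]; rewrite q0P.
have [||Q [vQ]] := @close_of_hyperplanes n d f _ (fun c => (q c).1) (fun c => (q c).2) _ _ Gd.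
- by move=> c /qP/andP[].
- by move=> c /qP/andP[].
- by rewrite leqNgt nfar.
Qed.

Lemma rej_hyperplanes (k n m : nat) (f : F2vec n -> 'F_2) (S : {set F2vec n}) (rho : R) :
  n = m.+1 -> (k <= n)%N ->
  (forall c b, c \in S -> rho * 2 ^+ (m * k.+1) <= #|cubes_in k f c b|%:R) ->
  #|S|%:R / 2 ^+ n * rho <= rej R k f.
Proof.
move=> nm kn lower; rewrite /rej ler_pdivlMr ?exprn_gt0 //.
have : \sum_(c in S) \sum_(b : 'F_2) rho * 2 ^+ (m * k.+1) <=
       (\sum_(c : F2vec n) \sum_b #|cubes_in k f c b|)%:R.
  rewrite natr_sum [leRHS](bigID (mem S)) /= -[leLHS]addr0; apply: lerD.
    by apply: ler_sum => c cS; rewrite natr_sum; apply: ler_sum => b _; apply: lower.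
  by apply: sumr_ge0 => c _; apply: ler0n.
rewrite sum_cubes_in natrM natrX; under eq_bigr do rewrite sumr_const card_Fp //.
rewrite sumr_const -mulrnA -[leLHS]mulr_natr natrM => h.
rewrite -(@ler_pM2r _ (2 ^+ (n - k))) ?exprn_gt0 //; apply: le_trans h.
(* The factor 2 stands for the two values of b; the counting weights balance exactly because n = m +
   1. *)
have e : 2 ^+ (n * k.+1) * 2 ^+ (n - k) = 2 * 2 ^+ (m * k.+1) * 2 ^+ n :> R.
  by rewrite -!exprS -!exprD; congr (_ ^+ _); subst n; lia.
rewrite -[leLHS]mulrA e le_eqVlt; apply/orP; left; apply/eqP; field.
by rewrite expf_neq0 ?pnatr_eq0.
Qed.

(** The factor 1/2 + 2^-(m+1) starts at 1 and decreases to 1/2, and its decrease pays for the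
    exceptional hyperplanes: with y = 2^-(m+2), (1 - y/2)(1/2 + 2y) >= 1/2 + y. *)
Lemma rej_far (d m n : nat) (f : F2vec n -> 'F_2) : n = (d + 8 + m)%N ->
  far d f -> 2 ^- 9 * (1 / 2 + 2 ^- m.+1) <= rej R d.+1 f.
Proof.
elim: m n f => [|m IHm] n f nE ff.
  apply: le_trans (rej_small_dim _ (far_nonvanish ff)); last by rewrite nE addn0.
  by rewrite ler_piMr ?invr_ge0 ?exprn_ge0 // expr1; lra.
have y0 : 0 < 2 ^- m.+2 :> R by rewrite invr_gt0 exprn_gt0.
have y1 : 2 ^- m.+2 <= 1 / 4 :> R.
  rewrite div1r lef_pV2 ?posrE ?exprn_gt0 // (_ : 4 = 2 ^+ 2); last by ring.
  by rewrite ler_eXn2l // ltr1n.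
have [/existsP[P /andP[vP cP]]|nmid] := boolP [exists P : boolfun n, vanish d.+1 P &&
    (#|[set x | f x != P x]| * 2 ^ (d + 2) <= 2 ^ n)%N].
  apply: le_trans (rej_mid_range ff vP cP).
  by rewrite ler_piMr ?invr_ge0 ?exprn_ge0 //; lra.
rewrite addnS in nE; set n' := (d + 8 + m)%N in nE IHm; subst n.
set G := [set c : F2vec n'.+1 | [exists q, close_side d f c q]].
have cG : (#|G| < 2 ^ (d + 6))%N.
  apply: card_close_side => P vP; rewrite ltnNge; apply: contra nmid => cP.
  apply/existsP; exists (finfun P).
  rewrite (eq_vanish _ (g := P)) ?vP => [/=|x]; last by rewrite ffunE.
  by apply: leq_trans cP; rewrite leq_mul2r; apply/orP; right;
    apply/subset_leq_card/subsetP => x; rewrite !inE ffunE.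
set rho : R := 2 ^- 9 * (1 / 2 + 2 ^- m.+1) in IHm *.
have rhoE : rho = 2 ^- 9 * (1 / 2 + 2 * 2 ^- m.+2).
  rewrite /rho [2 ^+ m.+2]exprS; congr (_ * (_ + _)); field.
  by rewrite expf_neq0 ?pnatr_eq0.
have dn : (d < n'.+1)%N by rewrite /n'; lia.
(* The vector 0 defines no hyperplane and is excluded along with G. Together they have at most
   2^(d+6) elements, a fraction 2^-(m+3) of the directions. *)
apply: le_trans (@rej_hyperplanes d.+1 _ n' f (~: (0 |: G)) rho erefl dn _) => [|c b].
  have cS : 1 - 2 ^- m.+2 / 2 <= #|~: (0 |: G)|%:R / 2 ^+ n'.+1 :> R.
    rewrite ler_pdivlMr ?exprn_gt0 // mulrBl mul1r cardsCs setCK card_F2vec.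
    have cG0 : (#|0%R |: G| <= 2 ^ (d + 6))%N.
      by rewrite cardsU1; apply: leq_trans cG; rewrite -[leqRHS]add1n leq_add2r leq_b1.
    have dn6 : (2 ^ (d + 6) <= 2 ^ n'.+1)%N by rewrite leq_exp2l // /n'; lia.
    rewrite natrB ?(leq_trans cG0) // natrX lerB //.
    rewrite (_ : _ * _ = (2 ^ (d + 6))%:R) ?ler_nat // natrX.
    rewrite (_ : n'.+1 = (d + 6) + m.+2.+1)%N ?/n'; last lia.
    rewrite exprD [2 ^+ m.+3]exprS; field; by rewrite expf_neq0 ?pnatr_eq0.
  apply: le_trans (ler_wpM2r _ cS); rewrite ?rhoE.
    move: (2 ^- m.+2) y0 y1 => y y0 y1; rewrite mulrCA ler_wpM2l ?invr_ge0 ?exprn_ge0 //; nra.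
  by rewrite mulr_ge0 ?invr_ge0 ?exprn_ge0 //; lra.
rewrite !inE negb_or => /andP[c0 nG].
have [a [M [Mfree Mb Msurj]]] := hyperplane_param b c0.
have := IHm _ _ erefl (far_hyperplane Mfree Msurj nG).
rewrite /rej ler_pdivlMr ?exprn_gt0 // => h; apply: le_trans h _.
by rewrite ler_nat; apply: card_odd_cubes_hyperplane.
Qed.
End Rejection.

Lemma rej_far_lower (R : realFieldType) (d n : nat) (f : F2vec n -> 'F_2) :
  far d f -> 2 ^- 10 <= rej R d.+1 f.
Proof.
move=> ff; have [nd|nd] := leqP n (d + 8).
  apply: le_trans (rej_small_dim _ nd (far_nonvanish ff)).
  by rewrite lef_pV2 ?posrE ?exprn_gt0 // ler_eXn2l ?ltr1n.
have nE : n = (d + 8 + (n - (d + 8)))%N by rewrite subnKC // ltnW.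
apply: le_trans (rej_far R nE ff).
rewrite exprSr invfM ler_wpM2l ?invr_ge0 ?exprn_ge0 //.
have : 0 <= 2 ^- (n - (d + 8)).+1 :> R by rewrite invr_ge0 exprn_ge0.
lra.
Qed.

(** * From parallelepipeds to affine subspaces *)

Definition flat (k n : nat) (p : F2vec n * 'M['F_2]_(k, n)) : {set F2vec n} :=
  affine_map p.1 p.2 @: [set: F2vec k].

Lemma affine_map_inj (k n : nat) a (M : 'M['F_2]_(k, n)) :
  row_free M -> injective (affine_map a M).
Proof. by move=> Mfree u v /addrI/(row_free_inj Mfree). Qed.

Lemma cubesum_flat (k n : nat) (f : F2vec n -> 'F_2) p : row_free p.2 ->
  cubesum f p.1 p.2 = \sum_(x in @flat k n p) f x.
Proof.
move=> Mfree; rewrite /flat big_imset /=; last by move=> u v _ _; apply: affine_map_inj.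
by rewrite /cubesum; apply: eq_bigl => u; rewrite inE.
Qed.

(** In dimension k, a parallelepiped with k independent directions is the whole space, and one with
    dependent directions has sum 0. *)
Lemma vanish_top (k : nat) (g : F2vec k -> 'F_2) : vanish k g = (\sum_u g u == 0).
Proof.
apply/vanish_cubesumP/eqP => [/(_ 0 1%:M) g0|g0 a M].
  by rewrite -[RHS]g0; apply: eq_bigr => u _; rewrite mulmx1 add0r.
have [Mfree|/cubesum_not_free//] := boolP (row_free M).
by rewrite -g0 [RHS](reindex_inj (affine_map_inj (a := a) Mfree)).
Qed.

Lemma GN_accepts_flat (d n : nat) (f : boolfun n) (p : F2vec n * 'M_(d.+1, n)) :
  row_free p.2 -> GN_accepts d f (flat p) = (cubesum f p.1 p.2 == 0).
Proof.
move=> pfree.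
have degE a M : row_free M -> (deg (pullback f a M) <= d)%N =
    (\sum_(x in @flat d.+1 n (a, M)) f x == 0).
  move=> Mfree; rewrite -cubesum_flat // (sameP (deg_leP _ _) idP) vanish_top.
  by congr (_ == 0); apply: eq_bigr => u _; rewrite ffunE.
rewrite cubesum_flat //; apply/forallP/idP => [/(_ p.1)/forallP/(_ p.2)|p0 a].
  by rewrite pfree eqxx /= degE // -surjective_pairing.
by apply/forallP => M; apply/implyP => /andP[Mfree /eqP pE]; rewrite degE // /flat /= -pE.
Qed.

(** Parametrizations of a fixed flat differ by affine automorphisms of F_2^k, so all flats have
    equally many. A uniform flat is therefore the image of a uniform pair (a, M) with M row-free. *)
Lemma card_flat_fiber (k n : nat) A : A \in affine_subspaces k n ->
  #|[set p : F2vec n * 'M_(k, n) | row_free p.2 && (flat p == A)]| =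
  #|[set q : F2vec k * 'M['F_2]_k | row_free q.2]|.
Proof.
rewrite inE => /existsP[a0 /existsP[M0 /andP[M0free /eqP AE]]].
pose h (q : F2vec k * 'M['F_2]_k) := (affine_map a0 M0 q.1, q.2 *m M0).
have inj : injective h.
  move=> [u N] [v N'] [/addrI eu eN].
  by rewrite (row_free_inj M0free eu) (row_free_inj M0free eN).
have hE q u : affine_map (h q).1 (h q).2 u = affine_map a0 M0 (affine_map q.1 q.2 u).
  by rewrite /affine_map mulmxDl mulmxA addrA.
rewrite -[RHS](card_imset _ inj); apply: eq_card => -[a M]; rewrite inE /=.
apply/andP/imsetP => [[Mfree /eqP fA]|[q]].
  have inA u : exists v, affine_map a M u = affine_map a0 M0 v.
    have : affine_map a M u \in A by rewrite -fA; apply: imset_f.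
    by rewrite AE => /imsetP[v _ ->]; exists v.
  have [u0 a0E] := inA 0; rewrite {1}/affine_map mul0mx addr0 in a0E.
  have /submxP[N NM] : (M <= M0)%MS.
    apply/row_subP => i; have [v] := inA (delta_mx 0 i).
    rewrite /affine_map -rowE a0E /affine_map => e.
    apply/submxP; exists (v + u0); rewrite mulmxDl.
    move: e; rewrite -addrA => /addrI <-.
    by rewrite addrAC F2mx_addxx add0r.
  exists (u0, N); last by rewrite /h /= -NM -a0E.
  rewrite inE /row_free eqn_leq rank_leq_row /= -{1}(eqP Mfree) NM.
  by rewrite mxrankMfree.
rewrite inE => qfree hq; split.
  have -> : M = q.2 *m M0 by case: hq.
  by rewrite /row_free mxrankMfree.
rewrite hq AE /flat; apply/eqP/setP => x; apply/imsetP/imsetP => -[u _ ->].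
  by exists (affine_map q.1 q.2 u); rewrite ?inE ?hE.
have [v ->] : exists v, u = affine_map q.1 q.2 v.
  have uq : q.2 \in unitmx by rewrite -row_free_unit.
  exists ((u + q.1) *m invmx q.2).
  by rewrite /affine_map mulmxKV // addrC F2mx_addK.
by exists v; rewrite ?inE ?hE.
Qed.

Lemma card_flats (k n : nat) (E : pred {set F2vec n}) :
  (#|[set A in affine_subspaces k n | E A]| *
     #|[set q : F2vec k * 'M['F_2]_k | row_free q.2]|)%N =
  #|[set p : F2vec n * 'M_(k, n) | row_free p.2 && E (flat p)]|.
Proof.
rewrite -[RHS]sum1_card (partition_big (@flat k n) (mem [set A in affine_subspaces k n | E A])) /=.
  rewrite -sum_nat_const; apply: eq_bigr => A; rewrite inE => /andP[Ain EA].
  rewrite -(card_flat_fiber Ain) -sum1dep_card; apply: eq_bigl => p.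
  by rewrite !inE; case: eqP => [->|]; rewrite ?EA ?andbT ?andbF.
move=> p; rewrite !inE => /andP[pfree ->]; rewrite andbT.
by apply/existsP; exists p.1; apply/existsP; exists p.2; rewrite pfree eqxx.
Qed.

Lemma affine_subspaces_gt0 (k n : nat) : (k <= n)%N -> (0 < #|affine_subspaces k n|)%N.
Proof.
move=> kn; apply/card_gt0P; exists (@flat k n (0, pid_mx k)); rewrite inE.
apply/existsP; exists 0; apply/existsP; exists (pid_mx k).
by rewrite eqxx andbT /row_free rank_pid_mx.
Qed.

Lemma unif_probC (R : realType) (T : finType) (Omega : {set T}) (E : pred T) :
  (0 < #|Omega|)%N -> unif_prob R Omega (fun w => ~~ E w) = 1 - unif_prob R Omega E.
Proof.
move=> Omega0; rewrite /unif_prob -[X in X - _](@divff _ (#|Omega|%:R : R)) ?pnatr_eq0 -?lt0n //.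
rewrite -mulrBl; congr (_ / _); rewrite -(cardsID [set w | E w] Omega) natrD.
rewrite [in RHS](_ : _ :&: _ = [set w in Omega | E w]); last by apply/setP => w; rewrite !inE.
rewrite addrAC subrr add0r; congr (_%:R); apply: eq_card => w; rewrite !inE.
by rewrite andbC.
Qed.

Lemma unif_prob_flats (R : realType) (k n : nat) (E : pred {set F2vec n}) :
  unif_prob R (affine_subspaces k n) E =
  unif_prob R [set p : F2vec n * 'M_(k, n) | row_free p.2] (fun p => E (flat p)).
Proof.
rewrite /unif_prob; set m := #|[set q : F2vec k * 'M['F_2]_k | row_free q.2]|.
have m0 : m%:R != 0 :> R.
  rewrite pnatr_eq0 -lt0n; apply/card_gt0P; exists (0, 1%:M).
  by rewrite inE row_free_unit unitmx1.
have cancel_m (x y : R) : x / y = (x * m%:R) / (y * m%:R) by rewrite -mulf_div divff ?mulr1.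
rewrite [LHS]cancel_m -!natrM card_flats.
have := @card_flats k n predT; rewrite (_ : [set A in _ | predT A] = affine_subspaces k n).
  move=> ->; congr (_%:R / _%:R).
    by apply: eq_card => p; rewrite !inE.
  by apply: eq_card => p; rewrite !inE andbT.
by apply/setP => A; rewrite inE andbT.
Qed.

Lemma GN_reject_flats (R : realType) (d n : nat) (f : boolfun n) :
  unif_prob R (affine_subspaces d.+1 n) (fun A => ~~ GN_accepts d f A) =
  #|odd_cubes d.+1 f|%:R / #|[set p : F2vec n * 'M['F_2]_(d.+1, n) | row_free p.2]|%:R.
Proof.
rewrite unif_prob_flats /unif_prob; congr (_%:R / _); apply: eq_card => p; rewrite !inE.
have [pfree|/cubesum_not_free->] := boolP (row_free p.2); last by rewrite eqxx.
by rewrite GN_accepts_flat.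
Qed.

(** Odd parallelepipeds are row-free, so both sides have the same numerator, and the test has the
    smaller denominator. If there is no row-free M, there are no odd parallelepipeds and both sides
    are 0. *)
Lemma GN_reject_ge (R : realType) (d n : nat) (f : boolfun n) :
  rej R d.+1 f <= unif_prob R (affine_subspaces d.+1 n) (fun A => ~~ GN_accepts d f A).
Proof.
rewrite GN_reject_flats /rej; set F := [set p | _].
have [F0|F0] := posnP #|F|.
  rewrite (_ : odd_cubes _ _ = set0) ?cards0 ?mul0r //; apply/setP => p; rewrite !inE.
  have := card0_eq F0 p; rewrite !inE => /negbT/cubesum_not_free->.
  by rewrite eqxx.
rewrite ler_wpM2l // lef_pV2 ?posrE ?exprn_gt0 ?ltr0n //.
rewrite -natrX ler_nat; apply: leq_trans (max_card _) _.
by rewrite card_prod card_F2vec card_F2mx -expnD mulnSr [(d.+1 * n)%N]mulnC addnC.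
Qed.

(** Union bound: an odd flat contains a point where f and g differ, and for each fixed M every one
    of the 2^(d+1) vertices is uniform in a. *)
Lemma GN_reject_le (R : realType) (d n : nat) (f g : boolfun n) : (d.+1 <= n)%N ->
  g \in RM d n ->
  unif_prob R (affine_subspaces d.+1 n) (fun A => ~~ GN_accepts d f A) <=
  2 ^+ d.+1 * unif_prob R [set: F2vec n] (fun x => f x != g x).
Proof.
rewrite inE => dn /deg_leP vg.
rewrite GN_reject_flats /unif_prob cardsT card_F2vec natrX.
set E := [set x in setT | _]; set F := [set p | _].
pose F2 := [set M : 'M['F_2]_(d.+1, n) | row_free M].
have cF : #|F| = (2 ^ n * #|F2|)%N.
  rewrite -card_F2vec -cardsT -cardsX; apply: eq_card => -[a M].
  by rewrite !inE.
have F20 : (0 < #|F2|)%N.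
  by apply/card_gt0P; exists (pid_mx d.+1); rewrite inE /row_free rank_pid_mx.
have odd_le : (#|odd_cubes d.+1 f| <= 2 ^ d.+1 * (#|E| * #|F2|))%N.
  apply: (@leq_trans (\sum_(u : F2vec d.+1) #|[set p | (p \in F) && (affine_map p.1 p.2 u \in E)]|)).
    apply: (@leq_trans #|\bigcup_(u : F2vec d.+1)
        [set p | (p \in F) && (affine_map p.1 p.2 u \in E)]|).
      apply/subset_leq_card/subsetP => p; rewrite inE => odd.
      have pF : p \in F by rewrite inE; apply: contraNT odd => /cubesum_not_free->.
      have [u fgu] : exists u, f (affine_map p.1 p.2 u) != g (affine_map p.1 p.2 u).
        apply/existsP; apply: contraNT odd => /existsPn fg.
        have /vanish_cubesumP/(_ p.1 p.2) <- := vg; apply/eqP/eq_bigr => u _.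
        by apply/eqP; rewrite -[_ == _]negbK; apply: fg.
      by apply/bigcupP; exists u => //; rewrite inE pF !inE.
    elim/big_rec2: _ => [|u m A _ le]; first by rewrite cards0.
    by apply: leq_trans (leq_card_setU _ _) _; rewrite leq_add2l.
  rewrite -(card_F2vec d.+1) -[leqRHS]sum_nat_const; apply: leq_sum => u _.
  have inj : injective (fun p : F2vec n * 'M['F_2]_(d.+1, n) => (affine_map p.1 p.2 u, p.2)).
    by move=> [a M] [a' M'] [e eM]; move: e; rewrite eM => /addIr ->.
  rewrite -cardsX -[leqLHS](card_imset _ inj); apply/subset_leq_card/subsetP.
  by move=> _ /imsetP[[a M] + ->]; rewrite !inE /= andbC.
rewrite cF natrM natrX invfM mulrA [leRHS]mulrA ler_pdivrMr ?ltr0n //.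
rewrite mulrAC ler_wpM2r ?invr_ge0 ?exprn_ge0 //.
by rewrite -mulrA -natrX -!natrM ler_nat.
Qed.

(** * Independent runs, the distance, and the choice of constants *)

Lemma GN_runs_card (d n r : nat) : #|GN_runs d n r| = (#|affine_subspaces d.+1 n| ^ r)%N.
Proof.
rewrite -[in RHS](card_ord r) -card_ffun_on; apply: eq_card => A; rewrite inE.
by apply/forallP/ffun_onP.
Qed.

Lemma accept_probX (R : realType) (d n r : nat) (f : boolfun n) :
  accept_prob R d r f = unif_prob R (affine_subspaces d.+1 n) (GN_accepts d f) ^+ r.
Proof.
rewrite /accept_prob /unif_prob GN_runs_card natrX expr_div_n; congr (_ / _).
rewrite -natrX -[in RHS](card_ord r) -card_ffun_on; congr (_%:R); apply: eq_card => A.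
rewrite !inE; apply/andP/ffun_onP => [[/forallP Ain /forallP Aacc] i|h].
  by rewrite inE Ain Aacc.
by split; apply/forallP => i; have := h i; rewrite inE => /andP[].
Qed.

Lemma delta_attained (R : realType) (d n : nat) (f : boolfun n) :
  exists2 g, g \in RM d n & delta R d f = unif_prob R [set: F2vec n] (fun x => f x != g x).
Proof.
have zRM : [ffun=> 0] \in RM d n.
  rewrite inE; apply/deg_leP; rewrite (eq_vanish _ (g := fun=> 0)) ?vanish_zero // => x.
  by rewrite ffunE.
rewrite /delta (bigmin_eq_arg _ _ _ _ zRM) => [|g _].
  by case: arg_minP => // g gRM _; exists g.
rewrite /unif_prob ler_pdivrMr ?mul1r ?ler_nat ?ltr0n; last first.
  by rewrite cardsT card_F2vec expn_gt0.
by apply/subset_leq_card/subsetP => x; rewrite !inE.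
Qed.

Lemma delta_le (R : realType) (d n : nat) (f g : boolfun n) : g \in RM d n ->
  delta R d f <= unif_prob R [set: F2vec n] (fun x => f x != g x).
Proof. exact: bigmin_le_cond. Qed.

(** The slack between 1/8 and the 1/16 in [far] yields its strict inequality. *)
Lemma far_of_delta (R : realType) (d n : nat) (f : boolfun n) :
  1 / 8 * 2 ^- d <= delta R d f -> far d f.
Proof.
move=> df P vP; have gRM : finfun P \in RM d n.
  by rewrite inE; apply/deg_leP; rewrite (eq_vanish _ (g := P)) // => x; rewrite ffunE.
have := le_trans df (delta_le R f gRM); rewrite /unif_prob cardsT card_F2vec.
rewrite (_ : [set x in _ | _] = [set x | f x != P x]); last first.
  by apply/setP => x; rewrite !inE ffunE.
rewrite natrX ler_pdivlMr ?exprn_gt0 // => h.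
rewrite -(ltr_nat R) natrM !natrX exprD.
have n0 : 0 < 2 ^+ n :> R by rewrite exprn_gt0.
have d0 : 0 < 2 ^+ d :> R by rewrite exprn_gt0.
have : 2 ^+ d * (1 / 8 * 2 ^- d * 2 ^+ n) <= 2 ^+ d * #|[set x | f x != P x]|%:R :> R by rewrite ler_pM2l.
rewrite (_ : _ * (_ * _) = 2 ^+ n / 8); last by field; rewrite gt_eqF.
lra.
Qed.

Lemma Bernoulli_le (R : realFieldType) (y : R) r : -1 <= y -> 1 + r%:R * y <= (1 + y) ^+ r.
Proof.
move=> y1; elim: r => [|r IHr]; first by rewrite mul0r addr0.
have := ler_wpM2l (_ : 0 <= 1 + y) IHr; rewrite -exprS => /(_ _) h.
apply: le_trans (h _); last by lra.
have := mulr_ge0 (ler0n R r) (sqr_ge0 y); rewrite -natr1; lra.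
Qed.

Theorem theorem3 (R : realType) :
  exists (c1 c2 : R) (r : nat),
    0 < c1 /\ 0 < c2 /\ (1 <= r)%N /\
    forall (d n : nat) (f : boolfun n), (d.+1 <= n)%N ->
      (delta R d f <= c1 * 2 ^- d -> 2 / 3 <= accept_prob R d r f) /\
      (c2 * 2 ^- d <= delta R d f -> 2 / 3 <= reject_prob R d r f).
Proof.
pose r := (2 ^ 11)%N.
have r0 : (0 < r)%N by rewrite expn_gt0.
have rR : r%:R * 2 ^- 10 = 2 :> R by rewrite natrX exprS mulfK ?expf_neq0 ?pnatr_eq0.
(* Only r > 0 and r 2^-10 = 2 are kept, so that the number 2^11 is never unfolded. *)
move: r r0 rR => r r0 rR.
have rR0 : 0 < r%:R :> R by rewrite ltr0n.
(* With this c1 a single run rejects with probability at most 2^(d+1) c1 2^-d = 1/(3r), so r runs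
   lose at most 1/3. *)
exists (1 / (6 * r%:R)), (1 / 8), r; split; first by rewrite divr_gt0 ?mulr_gt0.
split; first by lra.
split=> // d n f dn; have X0 := affine_subspaces_gt0 dn.
have runs0 : (0 < #|GN_runs d n r|)%N by rewrite GN_runs_card expn_gt0 X0.
rewrite /reject_prob unif_probC // -/(accept_prob R d r f) accept_probX.
have := unif_probC R (GN_accepts d f) X0.
set p := unif_prob R _ (GN_accepts d f) => pE.
have p0 : 0 <= p by rewrite divr_ge0.
split=> [df|df].
  have [g gRM dE] := delta_attained R d f; rewrite dE in df.
  have := GN_reject_le R f dn gRM; rewrite pE => le.
  have {le} x1 : 1 - p <= 2 * (1 / (6 * r%:R)).
    apply: le_trans le _; rewrite exprSr -mulrA.
    rewrite mulrCA ler_pM2l // mulrC -ler_pdivlMr ?exprn_gt0 //.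
  have rx : r%:R * (1 - p) <= 1 / 3.
    apply: le_trans (_ : r%:R * (2 * (1 / (6 * r%:R))) <= _); first by rewrite ler_pM2l.
    by rewrite le_eqVlt; apply/orP; left; apply/eqP; field; rewrite gt_eqF.
  have := @Bernoulli_le R (p - 1) r; rewrite [X in X ^+ _]addrC subrK => h.
  by apply: le_trans (h _); lra.
have := GN_reject_ge R d f; rewrite pE => le.
have {le} le := le_trans (rej_far_lower R (far_of_delta df)) le.
set rho : R := 2 ^- 10 in rR le.
have rho0 : 0 < rho by rewrite invr_gt0 exprn_gt0.
(* As p <= 1 - rho, the product p^r (1 + rho)^r is at most (1 - rho^2)^r <= 1; with (1 + rho)^r >= 1
   + r rho = 3 this gives p^r <= 1/3. *)
have h : 3 <= (1 + rho) ^+ r.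
  by apply: le_trans (Bernoulli_le _ _); rewrite ?rR; lra.
have : p ^+ r * (1 + rho) ^+ r <= 1.
  by rewrite -exprMn exprn_ile1 //; nra.
have := exprn_ge0 r p0; move: (p ^+ r) ((1 + rho) ^+ r) h => s t; nra.
Qed.
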